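(* (1) If $m>2$, then $\lceil\sqrt m\,\rceil\le\delta(m)\le m$. (2) Let $n\ge 1$. Then $k_{n^2-j}(n)=k_j(n)$ for all $0\le j\le n^2$. Consequently, if $\lceil\sqrt{n^2-j}\,\rceil=n$ and $k_j(n)>0$, then $\delta(n^2-j)=n$. In particular: (a) $k_{n^2-1}(n)=k_1(n)=1$ and $\delta(n^2-1)=n$; (b) if $n$ is even, $k_{n^2-2}(n)=k_2(n)=1$ and $\delta(n^2-2)=n$; (c) if $n\ge 3$, $k_{n^2-3}(n)=k_3(n)>0$ and $\delta(n^2-3)=n$; (d) $k_{n^2-n}(n)=k_n(n)>0$ and $\delta(n^2-n)=n$. Here every assertion about a value $\delta(m)$ is made for those $m$ with $m>2$, where $\delta(m)$ is defined.
   Context: For partitions $\lambda,\mu,\nu$ of the same integer $d$, $k(\lambda,\mu,\nu)$ denotes the Kronecker coefficient, i.e. the multiplicity of the trivial representation in $[\lambda]\otimes[\mu]\otimes[\nu]$, where $[\lambda]$ is the irreducible complex representation of the symmetric group $S_d$ indexed by $\lambda$. For integers $m\ge 0,\delta\ge 1$, $m\times\delta:=(\delta,\dots,\delta)$ ($m$ times) is the rectangular partition of $m\delta$ with $m$ rows of length $\delta$ (the empty partition if $m=0$). Put $k_m(\delta):=k(m\times\delta,m\times\delta,m\times\delta)$. For $m>2$, $\delta(m):=\min\{\delta\in\mathbb{N},\ \delta\ge 1 \mid k_m(\delta)>0\}$. *)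

(* Defs.v *)
From HB Require Import structures.
From mathcomp Require Import all_boot all_order all_algebra.
From mathcomp Require Import all_fingroup all_solvable all_field all_character.

Set Implicit Arguments.
Unset Strict Implicit.
Unset Printing Implicit Defensive.

Import Order.TTheory GroupScope GRing.Theory Num.Theory.
Local Open Scope ring_scope.

(* Complex representations are, as in MathComp's character theory,            *)
(* representations over algC.                                                 *)

(* A partition of d is given by the sequence of its parts (with sum d); its   *)
(* cells are numbered by 'I_d row by row, so that the entry i of the          *)
(* resulting tableau is in row [reshape_index lambda i] and column            *)
(* [reshape_offset lambda i].                                                 *)
Section SpechtModule.

Variables (d : nat) (lambda : seq nat).

Definition row_stab : {set 'S_d} :=
  [set s : 'S_d | [forall i : 'I_d, reshape_index lambda (s i) == reshape_index lambda i]].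

Definition col_stab : {set 'S_d} :=
  [set s : 'S_d | [forall i : 'I_d, reshape_offset lambda (s i) == reshape_offset lambda i]].

Local Notation aG := (regular_repr algC [set: 'S_d]%G).

(* In MathComp, (q * p) x = p (q x): this is the usual Young symmetrizer      *)
(* \sum_p p \o \sum_q sgn(q) q, where p ranges over the row stabilizer and q  *)
(* over the column stabilizer; and the action of aG x, right multiplication   *)
(* by x, is the usual left multiplication. Hence the module indexed by (d) is *)
(* trivial and the one indexed by (1^d) is the sign representation.           *)
Definition young_symmetrizer : 'rV[algC]_#|[set: 'S_d]| :=
  gring_row (\sum_(q in col_stab) \sum_(p in row_stab) (-1) ^+ q *: aG (q * p)%g).

Definition specht_mx := cyclic_mx aG young_symmetrizer.

Definition specht_repr :=
  submod_repr (cyclic_mx_module aG young_symmetrizer : mxmodule aG specht_mx).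

End SpechtModule.

Definition triv_mult (gT : finGroupType) (G : {group gT}) n
    (rG : mx_representation algC G n) : nat :=
  standard_irr_coef rG (principal_comp (DecSocleType (regular_repr algC G))).

Definition kronecker (d : nat) (lambda mu nu : seq nat) : nat :=
  triv_mult (prod_repr (prod_repr (specht_repr d lambda) (specht_repr d mu))
                       (specht_repr d nu)).

Definition rect (m delta : nat) : seq nat := nseq m delta.

Definition krect (m delta : nat) : nat :=
  kronecker (m * delta) (rect m delta) (rect m delta) (rect m delta).

(* [is_delta m delta] states that the minimum delta(m) exists and is delta.   *)
Definition is_delta (m delta : nat) : Prop :=
  [/\ (1 <= delta)%N, (0 < krect m delta)%N &
      forall delta' : nat,
        (1 <= delta')%N -> (0 < krect m delta')%N -> (delta <= delta')%N].

Definition ceil_sqrt (m : nat) : int := Num.ceil (sqrtC (m%:R : algC)).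

(* Main.v *)
(* For a tableau of rectangular shape with rows [row] and columns [col], the functions f
   of words w : 'I_d -> 'I_m with sum_w f(w) prod_p A(v p, w p) = det(A)^delta f(v) for all A form
   a model of the Specht module: polarizing this identity shows that the projection
   [proj_ker] onto the span of the products of column determinants fixes every such f, and
   the trace of a permutation on it is that of the Young symmetrizer. Hence k_m(delta) is
   the dimension of the GL_m^3-semi-invariants of weight det^delta in Sym^(m delta)(C^m^(x)3),
   and, transposing the tableau, of those of weight det^m in Lambda^(m delta)(C^delta^(x)3).

   In the exterior model the space is zero when m > delta^2, and the Hodge star gives
   k_(n^2-j)(n) = k_j(n). In the symmetric model, multiplication of polynomials gives
   k_m(a) k_m(b) > 0 -> k_m(a+b) > 0, and density of the orbit of the unit tensor in the
   2 x 2 x 2 tensors gives k_2(n) <= 1.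

   k_n(n) > 0: the square character chi vanishes at odd permutations, so it splits on Alt_d
   as xi1 + xi2, and a parity argument on xi1 - xi2 modulo 2 shows <chi^2, chi> <> 0. Then
   k_3(2) = k_1(2) = 1 and k_3(3) > 0 give k_3(n) > 0 for all n >= 2. *)

Require Import Defs.
From mathcomp Require Import all_boot all_order all_algebra.
From mathcomp Require Import all_fingroup all_solvable all_field all_character.
From mathcomp Require Import ring zify.
Import Order.TTheory GRing.Theory Num.Theory.
Set Implicit Arguments.
Unset Strict Implicit.
Unset Printing Implicit Defensive.
Local Open Scope ring_scope.

(** * Polarization, idempotents and determinants *)

(** One dimension formula, [tinv_dim], serves every number of factors. With three it gives the
    Kronecker coefficient; with two it gives the norm of the character, and this is how the square
    character is shown irreducible: its two-factor space has dimension at most 1. Covariance is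
    imposed for all matrices, singular ones included. This allows substituting 0/1-combinations of
    matrix units (Ryser's formula then isolates single words), and later lets degenerate matrices
    move a tensor out of a given orbit. The obstacle for k_n(n) is that the terms chi^3 have no
    constant sign, so positivity is replaced by counting powers of 2. Where xi1 - xi2 is nonzero the
    centralizer lies in Alt_d and has odd order, so the class size already contains the full 2-part
    of d!. The congruence modulo 2 supplies one further factor 2, which is one too many. *)

Lemma sum_injectiveb_perm (R : nmodType) (T : finType) (F : {ffun T -> T} -> R) :
  \sum_(f : {ffun T -> T} | injectiveb f) F f = \sum_(s : {perm T}) F (val s).
Proof.
rewrite (reindex (@pval _)) /=; last first.
  pose in_S := insubd (1%g : {perm T}).
  by exists in_S => /= f Uf; first apply: val_inj; apply: insubdK.
by apply: eq_bigl => s; rewrite (valP s).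
Qed.

Lemma not_injective_missed (T : finType) (f : {ffun T -> T}) :
  ~~ injectiveb f -> exists j, forall i, f i != j.
Proof.
move=> nif; suff /existsP[j /forallP hj]: [exists j, [forall i, f i != j]] by exists j.
apply: contraR nif => /existsPn hf; apply/card_uniqP.
rewrite size_codom; apply: eq_card => j; rewrite inE.
by have /forallPn[i /negPn/eqP <-] := hf j; rewrite codom_f.
Qed.

(** Ryser's formula for the permanent. After expansion, a map [f] that misses a value [j]
    contributes 0, because toggling [j] in [S] is a sign-reversing involution on the sets containing
    the image of [f]; a bijective [f] leaves only the full set. *)
Lemma ryser (R : numDomainType) d (y : 'I_d -> 'I_d -> R) :
  \sum_(S : {set 'I_d}) (-1) ^+ #|~: S| * \prod_i \sum_(j in S) y i j
  = \sum_(b : 'S_d) \prod_i y i (b i).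
Proof.
transitivity (\sum_(f : {ffun 'I_d -> 'I_d}) \sum_(S : {set 'I_d} | [forall i, f i \in S])
   (-1) ^+ #|~: S| * \prod_i y i (f i)).
  under eq_bigr => S _ do rewrite bigA_distr_big big_distrr /=.
  rewrite (exchange_big_dep predT) //=; apply: eq_bigr => f _; apply: eq_bigl => S.
rewrite (bigID (fun f : {ffun 'I_d -> 'I_d} => injectiveb f)) /= [X in _ + X]big1 ?addr0; last first.
  move=> f /not_injective_missed[j hj]; rewrite -big_distrl /=.
  suff -> : \sum_(S : {set 'I_d} | [forall i, f i \in S]) (-1) ^+ #|~: S| = 0 :> R by rewrite mul0r.
  pose t (S : {set 'I_d}) := if j \in S then S :\ j else j |: S.
  have tK : involutive t.
    move=> S; rewrite /t; have [jS|jS] := boolP (j \in S); first by rewrite setD11 setD1K.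
    by rewrite setU11 setU1K.
  have tC S : (-1) ^+ #|~: t S| = - (-1) ^+ #|~: S| :> R.
    rewrite /t; case: ifP => jS.
      rewrite setCD setUC -[_ :|: _]/(_ |: _) cardsU1 inE jS /= add1n exprS mulN1r //.
    have jS' : j \in ~: S by rewrite inE jS.
    rewrite [#|~: S|](cardsD1 j) jS' add1n exprS mulN1r opprK; congr (_ ^+ _).
    by apply: eq_card => k; rewrite !inE negb_or.
  set s := \sum_(S | _) _.
  have: s = - s.
    rewrite {1}/s (reindex_inj (inv_inj tK)) /= -sumrN; apply: eq_big => [S|S _]; last exact: tC.
    apply/forallP/forallP => h i; have := h i; rewrite /t; case: ifP => _; rewrite !inE ?hj //;
      by rewrite (negPf (hj i)).
  by move/eqP; rewrite -subr_eq0 opprK -mulr2n mulrn_eq0 /= => /eqP.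
rewrite sum_injectiveb_perm; apply: eq_bigr => b _.
rewrite (bigD1 [set: 'I_d]) /=; last by apply/forallP => i; rewrite inE.
rewrite setCT cards0 expr0 mul1r [X in _ + X]big1 ?addr0; last first.
  move=> S /andP[/forallP hS /negP[]]; apply/eqP/setP => i; rewrite inE.
  by have := hS ((b^-1)%g i); rewrite pvalE permKV.
by apply: eq_bigr => i _; rewrite pvalE.
Qed.

(** In the rank factorization P = C R, idempotence gives R C = 1, and tr(C R) = tr(R C). *)
Lemma mxtrace_idem (F : fieldType) n (P : 'M[F]_n) :
  P *m P = P -> \tr P = (\rank P)%:R.
Proof.
move=> PP; have RC : row_base P *m col_base P = 1%:M.
  apply: (row_free_inj (row_base_free P)); apply: (row_full_inj (col_base_full P)).
  by rewrite mul1mx -[X in _ *m X]mulmxA mulmxA mulmx_base PP.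
by rewrite -[in LHS](mulmx_base P) mxtrace_mulC RC mxtrace1.
Qed.

Lemma poly_nonroot (R : numDomainType) (p : {poly R}) : p != 0 -> exists x, p.[x] != 0.
Proof.
move=> p0; pose rs : seq R := [seq i%:R | i <- iota 0 (size p)].
have : ~~ all (root p) rs.
  apply/negP => rp; have := max_poly_roots p0 rp; rewrite size_map size_iota ltnn.
  by rewrite map_inj_uniq ?iota_uniq // => [/(_ isT)|i j /eqP] //; rewrite eqr_nat => /eqP.
by case/allPn => x _ rx; exists x.
Qed.

Lemma poly_eq0 (R : numDomainType) (p : {poly R}) : (forall x, p.[x] = 0) -> p = 0.
Proof. by move=> hp; apply/eqP/negPn/negP => /poly_nonroot[x]; rewrite hp eqxx. Qed.

Lemma poly_eq0_dense (R : numDomainType) (p q : {poly R}) :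
  q != 0 -> (forall x, q.[x] != 0 -> p.[x] = 0) -> p = 0.
Proof.
move=> q0 h; suff /eqP: p * q = 0 by rewrite mulf_eq0 (negPf q0) orbF => /eqP.
apply: poly_eq0 => x; rewrite hornerM; case: (eqVneq q.[x] 0) => [->|/h ->].
  by rewrite mulr0.
by rewrite mul0r.
Qed.

Lemma det_reindex (R : comNzRingType) (T : finType) N (e e' : 'I_N -> T) (M : T -> T -> R) :
  bijective e -> bijective e' ->
  \det (\matrix_(i, j) M (e i) (e j)) = \det (\matrix_(i, j) M (e' i) (e' j)).
Proof.
move=> [g eK gK] /bij_inj inj'.
have si : injective (g \o e') by apply: inj_comp => //; apply: can_inj gK.
pose s := perm si.
have -> : \matrix_(i, j) M (e' i) (e' j) = row_perm s (col_perm s (\matrix_(i, j) M (e i) (e j))).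
  by apply/matrixP => i j; rewrite !mxE !permE /= !gK.
rewrite row_permE col_permE !det_mulmx !det_perm odd_permV mulrCA.
by rewrite -signr_addb addbb mulr1.
Qed.

(** The matrix is A tensored with the identity of size [delta], indexed by the cells. The induction
    splits off column 0 as a diagonal block [A]. *)
Lemma det_block_diag (R : comNzRingType) m delta N (A : 'M[R]_m)
    (row : 'I_N -> 'I_m) (col : 'I_N -> 'I_delta) :
  bijective (fun i => (row i, col i)) ->
  \det (\matrix_(i, j) (A (row i) (row j) * (col i == col j)%:R)) = \det A ^+ delta.
Proof.
elim: delta N row col => [|delta IH] N row col bij.
  have N0 : N = 0%N.
    by have := bij_eq_card bij; rewrite card_prod !card_ord muln0.
  by subst N; rewrite det_mx00.
pose T' : finType := ('I_m * 'I_delta)%type; pose N' := #|T'|.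
have NE : N = (m + N')%N.
  by have := bij_eq_card bij; rewrite /N' !card_prod !card_ord mulnS.
subst N.
pose e' (i : 'I_(m + N')) : 'I_m * 'I_delta.+1 :=
  match split i with
  | inl a => (a, ord0)
  | inr k => ((enum_val k : T').1, lift ord0 (enum_val k : T').2)
  end.
have bij' : bijective e'.
  apply: inj_card_bij; last by rewrite !card_prod !card_ord mulnS /N' !card_prod !card_ord.
  move=> i j; rewrite /e' -{2}[i]splitK -{2}[j]splitK.
  case: (split i) => a; case: (split j) => b //=.
  - by move=> [->].
  - move=> E; have /= E1 := congr1 fst E; have /= /lift_inj E2 := congr1 snd E.
    by congr (rshift _ _); apply: enum_val_inj; apply/eqP; rewrite -pair_eqE /= E1 E2 !eqxx.
pose M (x y : 'I_m * 'I_delta.+1) := A x.1 y.1 * (x.2 == y.2)%:R.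
transitivity (\det (\matrix_(i, j) M (e' i) (e' j))).
  by rewrite -(det_reindex M bij bij'); congr (\det _); apply/matrixP => i j; rewrite !mxE.
have -> : \matrix_(i, j) M (e' i) (e' j) = block_mx A 0 0
   (\matrix_(i < N', j < N') (A (enum_val i : T').1 (enum_val j : T').1
       * ((enum_val i : T').2 == (enum_val j : T').2)%:R)).
  apply/matrixP => i j; rewrite !mxE /M /e'.
  case: (split i) => a; rewrite mxE; case: (split j) => b; rewrite ?mxE /=.
  - by rewrite mulr1.
  - by rewrite mulr0.
  - by rewrite mulr0.
  - by rewrite (inj_eq (@lift_inj _ ord0)).
rewrite det_ublock exprS; congr (_ * _).
rewrite (IH _ (fun i => (enum_val i : T').1) (fun i => (enum_val i : T').2)) //.
have [g h1 h2] := @enum_val_bij T'.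
by exists g => x; [rewrite -surjective_pairing h1 | rewrite h2 -surjective_pairing].
Qed.

(** * Covariant tensors and the tableau projection *)

Definition shift (T : Type) d (w : {ffun 'I_d -> T}) (h : 'S_d) : {ffun 'I_d -> T} :=
  [ffun p => w (h p)].

Lemma shiftM (T : Type) d (w : {ffun 'I_d -> T}) (g h : 'S_d) :
  shift (shift w g) h = shift w (h * g).
Proof. by apply/ffunP => p; rewrite !ffunE permM. Qed.

Lemma shift1 (T : Type) d (w : {ffun 'I_d -> T}) : shift w 1 = w.
Proof. by apply/ffunP => p; rewrite !ffunE perm1. Qed.

Lemma shiftK (T : Type) d (h : 'S_d) :
  cancel (fun w : {ffun 'I_d -> T} => shift w h) (fun w => shift w h^-1).
Proof. by move=> w; rewrite shiftM mulVg shift1. Qed.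

Lemma shiftVK (T : Type) d (h : 'S_d) :
  cancel (fun w : {ffun 'I_d -> T} => shift w h^-1) (fun w => shift w h).
Proof. by move=> w; rewrite shiftM mulgV shift1. Qed.

Lemma shift_inj (T : Type) d (h : 'S_d) :
  injective (fun w : {ffun 'I_d -> T} => shift w h).
Proof. exact: can_inj (shiftK h). Qed.

Lemma shift_eq (T : eqType) d (v w : {ffun 'I_d -> T}) (h : 'S_d) :
  (shift v h == shift w h) = (v == w).
Proof. exact: inj_eq (@shift_inj T d h) v w. Qed.

Lemma shift_eql (T : eqType) d (v w : {ffun 'I_d -> T}) (h : 'S_d) :
  (shift v h == w) = (v == shift w h^-1).
Proof. exact: can2_eq (shiftK h) (@shiftVK T d h) v w. Qed.

Lemma prod_eqb (R : comNzSemiRingType) d (T : eqType) (v w : {ffun 'I_d -> T}) :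
  \prod_p (v p == w p)%:R = (v == w)%:R :> R.
Proof.
case: eqP => [->|/eqP ne]; first by rewrite big1 // => p _; rewrite eqxx.
have /existsP[p ne'] : [exists p, v p != w p].
  apply: contraR ne; rewrite negb_exists => /forallP h; apply/eqP/ffunP => p.
  by apply/eqP/negPn/h.
by rewrite (bigD1 p) //= (negPf ne') mul0r.
Qed.

Lemma sum_eqb (R : pzSemiRingType) (T : finType) (a : T) (F : T -> R) :
  \sum_x (x == a)%:R * F x = F a.
Proof.
rewrite (bigD1 a) //= eqxx mul1r big1 ?addr0 // => x /negPf ->.
by rewrite mul0r.
Qed.

(** [f] is a tensor in the d-th tensor power of C^m that is semi-invariant of weight det^delta; [A]
    ranges over all matrices, so that [unit_comb] may be substituted for it. *)
Definition covar d m delta (f : {ffun 'I_d -> 'I_m} -> algC) :=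
  forall (A : 'M[algC]_m) (v : {ffun 'I_d -> 'I_m}),
    \sum_w f w * \prod_p A (v p) (w p) = \det A ^+ delta * f v.

Lemma eq_covar d m delta (f g : {ffun 'I_d -> 'I_m} -> algC) :
  f =1 g -> covar delta f -> covar delta g.
Proof. by move=> fg cf A v; rewrite -fg -cf; apply: eq_bigr => w _; rewrite fg. Qed.

Lemma covar_shift d m delta (f : {ffun 'I_d -> 'I_m} -> algC) (h : 'S_d) :
  covar delta f -> covar delta (fun v => f (shift v h)).
Proof.
move=> cf A v; rewrite -cf (reindex_inj (@shift_inj _ _ h^-1)) /=.
apply: eq_bigr => w _; rewrite shiftVK; congr (_ * _).
by rewrite (reindex_perm h) /=; apply: eq_bigr => p _; rewrite !ffunE permK.
Qed.

Lemma covar_sum d m delta (I : finType) (P : pred I) c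
    (f : I -> {ffun 'I_d -> 'I_m} -> algC) :
  (forall i, P i -> covar delta (f i)) -> covar delta (fun v => \sum_(i | P i) c i * f i v).
Proof.
move=> cf A v; rewrite big_distrr /=.
under eq_bigr => w _ do rewrite big_distrl /=.
rewrite exchange_big /=; apply: eq_bigr => i Pi.
rewrite mulrCA -cf // big_distrr /=; apply: eq_bigr => w _; by rewrite mulrA.
Qed.

(* Polarization: signed sums of the operators A^{\otimes d} over 0/1-combinations of
   matrix units produce the S_d-symmetrized matrix units. *)
Definition unit_comb d m (a b : {ffun 'I_d -> 'I_m}) (S : {set 'I_d}) : 'M[algC]_m :=
  \matrix_(x, y) \sum_(j in S) (x == a j)%:R * (y == b j)%:R.

(** For d = m delta, the form det^delta of degree d fully polarized at the d matrix units E_(a j, b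
    j). *)
Definition pol_det d m delta (a b : {ffun 'I_d -> 'I_m}) : algC :=
  \sum_(S : {set 'I_d}) (-1) ^+ #|~: S| * \det (unit_comb a b S) ^+ delta.

Lemma unit_comb_polarize d m (a b v w : {ffun 'I_d -> 'I_m}) :
  \sum_(S : {set 'I_d}) (-1) ^+ #|~: S| * \prod_p unit_comb a b S (v p) (w p)
  = \sum_(h : 'S_d) (v == shift a h)%:R * (w == shift b h)%:R.
Proof.
under eq_bigr => S _ do under eq_bigr => p _ do rewrite mxE.
rewrite (ryser (fun p j => (v p == a j)%:R * (w p == b j)%:R)).
apply: eq_bigr => h _; rewrite big_split /=; congr (_ * _).
  by rewrite -prod_eqb; apply: eq_bigr => p _; rewrite ffunE.
by rewrite -prod_eqb; apply: eq_bigr => p _; rewrite ffunE.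
Qed.

(** The signed sum over [S] of the covariance identities at [unit_comb a b S]. *)
Lemma covar_polarize d m delta (f : {ffun 'I_d -> 'I_m} -> algC) a b v :
  covar delta f ->
  \sum_(h : 'S_d) (v == shift a h)%:R * f (shift b h) = pol_det delta a b * f v.
Proof.
move=> cf; rewrite /pol_det big_distrl /=.
under [RHS]eq_bigr => S _ do rewrite -mulrA -cf big_distrr /=.
rewrite [RHS]exchange_big /=.
under [RHS]eq_bigr => w _.
  under eq_bigr => S _ do rewrite mulrCA.
  rewrite -big_distrr /= unit_comb_polarize big_distrr /=; over.
rewrite exchange_big /=; apply: eq_bigr => h _.
by under [RHS]eq_bigr => w _ do rewrite mulrA mulrC; rewrite sum_eqb mulrC.
Qed.

Section Tableau.

Variables (d m delta : nat) (row : 'I_d -> 'I_m) (col : 'I_d -> 'I_delta).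
Hypothesis bij : bijective (fun i => (row i, col i)).

(** Stabilizers for an arbitrary numbering of the cells, instead of the row-by-row one of
    [row_stab]: transposing the tableau is then just exchanging [row] and [col]. *)
Definition row_group := [set s : 'S_d | [forall i, row (s i) == row i]].
Definition col_group := [set s : 'S_d | [forall i, col (s i) == col i]].

Lemma row_groupP (s : 'S_d) : reflect (forall i, row (s i) = row i) (s \in row_group).
Proof. by rewrite inE; apply: (iffP forallP) => h i; apply/eqP/h. Qed.

Lemma col_groupP (s : 'S_d) : reflect (forall i, col (s i) = col i) (s \in col_group).
Proof. by rewrite inE; apply: (iffP forallP) => h i; apply/eqP/h. Qed.

Lemma row_groupM (g h : 'S_d) : g \in row_group -> (h * g \in row_group)%g = (h \in row_group).
Proof.
move=> /row_groupP hg; apply/row_groupP/row_groupP => hh i; have := hh i.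
  by rewrite permM hg.
by rewrite permM hg.
Qed.

Definition rword : {ffun 'I_d -> 'I_m} := [ffun p => row p].

(* The tensor of a product of determinants, one for each column of the tableau. *)
Definition det_tensor (w : {ffun 'I_d -> 'I_m}) : algC :=
  \sum_(q in col_group) (-1) ^+ q * (w == shift rword q)%:R.

(** The product over the columns c of the determinants of (X i (row j)), i and j in column c,
    written as one d x d determinant: right multiplication of X by A becomes a product with the
    matrix of [det_block_diag]. *)
Definition det_prod (X : 'I_d -> 'I_m -> algC) : algC :=
  \det (\matrix_(i, j) (X i (row j) * (col i == col j)%:R)).

Lemma sum_det_tensor (X : 'I_d -> 'I_m -> algC) :
  \sum_w det_tensor w * \prod_p X p (w p) = det_prod X.
Proof.
under eq_bigr => w _ do rewrite /det_tensor big_distrl /=.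
rewrite exchange_big /= /det_prod /determinant big_mkcond /=.
apply: eq_bigr => q _.
under [X in _ = _ * X]eq_bigr => i _ do rewrite mxE.
rewrite big_split /=; case: ifPn => [/col_groupP hq|/col_groupP nq].
  rewrite [X in _ = _ * (_ * X)]big1 ?mulr1; last by move=> i _; rewrite hq eqxx.
  under eq_bigr => w _ do rewrite -mulrA.
  rewrite -big_distrr /= sum_eqb; congr (_ * _).
  by apply: eq_bigr => p _; rewrite !ffunE.
have /existsP[i ni] : [exists i, col i != col (q i)].
  apply: contraPT nq; rewrite negb_exists => /forallP h; apply.
  by move=> i; apply/esym/eqP/negPn/h.
by rewrite [X in _ * (_ * X)](bigD1 i) //= (negPf ni) mul0r !mulr0.
Qed.

Lemma sum_cells (R : nmodType) (F : 'I_m -> 'I_delta -> R) :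
  \sum_k F (row k) (col k) = \sum_a \sum_c F a c.
Proof.
have [g gK Kg] := bij; rewrite pair_big /= (reindex g) /=; last first.
  by exists (fun i => (row i, col i)) => x _.
by apply: eq_bigr => x _; have := Kg x; case: x => a c /= [-> ->].
Qed.

Lemma det_prod_mul X (A : 'M[algC]_m) :
  det_prod (fun p b => \sum_a X p a * A a b) = det_prod X * \det A ^+ delta.
Proof.
rewrite -(det_block_diag A bij) -det_mulmx; congr (\det _); apply/matrixP => i j.
rewrite !mxE; under [RHS]eq_bigr => k _ do rewrite !mxE.
rewrite (sum_cells (fun a c => X i a * (col i == c)%:R * (A a (row j) * (c == col j)%:R))).
rewrite big_distrl /=; apply: eq_bigr => a _.
rewrite (bigD1 (col i)) //= big1 ?addr0; last first.
  by move=> c /negPf; rewrite eq_sym => ->; rewrite mulr0 mul0r.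
by rewrite eqxx mulr1 mulrA.
Qed.

Lemma det_tensorE v : det_tensor v = det_prod (fun p b => (v p == b)%:R).
Proof.
rewrite -sum_det_tensor; under eq_bigr => w _ do rewrite prod_eqb eq_sym mulrC.
by rewrite sum_eqb.
Qed.

Lemma covar_det_tensor : covar delta det_tensor.
Proof.
move=> A v; rewrite (sum_det_tensor (fun p b => A (v p) b)) det_tensorE mulrC -det_prod_mul.
rewrite /det_prod; congr (\det _); apply/matrixP => i j; rewrite !mxE; congr (_ * _).
by rewrite -(sum_eqb (v i) (fun a => A a (row j))); apply: eq_bigr => a _; rewrite eq_sym.
Qed.

Lemma shift_rword_eq (g h : 'S_d) :
  (shift rword g == shift rword h) = (h^-1 * g \in row_group)%g.
Proof.
apply/eqP/row_groupP => [/ffunP e i|e]; last apply/ffunP => p.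
  by have := e ((h^-1)%g i); rewrite !ffunE permKV permM.
by rewrite !ffunE -[in RHS](e) -permM mulgA mulgV mul1g.
Qed.

Lemma shift_rword_row_group h : (rword == shift rword h) = (h \in row_group).
Proof. by rewrite -[X in X == _](shift1 rword) eq_sym shift_rword_eq invg1 mul1g. Qed.

Lemma det_tensor_rword : det_tensor rword = 1.
Proof.
rewrite /det_tensor (bigD1 1%g) /=; last by apply/col_groupP => i; rewrite perm1.
rewrite odd_perm1 shift1 eqxx mulr1 big1 ?addr0 // => q /andP[/col_groupP hq nq].
rewrite shift_rword_row_group; case: row_groupP => [rq|]; last by rewrite mulr0.
case/eqP: nq; apply/permP => i; rewrite perm1; apply: (bij_inj bij).
by rewrite /= hq rq.
Qed.

Lemma det_tensor_int w : det_tensor w \in Num.int.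
Proof.
rewrite /det_tensor rpred_sum // => q _; rewrite rpredM ?rpred_nat //.
by rewrite rpredX // rpredN rpred1.
Qed.

(* Polarizes det(A)^delta as the covariance of det_tensor at A^T, whereas covar_polarize
   uses the covariance at A; comparing the two gives the positivity of hook_const. *)
Lemma pol_det_row_group a b :
  pol_det delta a b = \sum_(h | rword == shift b h) det_tensor (shift a h).
Proof.
have E S : \det (unit_comb a b S) ^+ delta =
    \sum_w det_tensor w * \prod_p unit_comb a b S (w p) (rword p).
  have := covar_det_tensor (unit_comb a b S)^T rword.
  rewrite det_tensor_rword mulr1 det_tr => <-; apply: eq_bigr => w _; congr (_ * _).
  by apply: eq_bigr => p _; rewrite mxE.
rewrite /pol_det; under eq_bigr => S _ do rewrite E big_distrr /=.
rewrite exchange_big /=; under eq_bigr => w _.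
  under eq_bigr => S _ do rewrite mulrCA.
  rewrite -big_distrr /= unit_comb_polarize big_distrr /=; over.
rewrite exchange_big /= [RHS]big_mkcond /=; apply: eq_bigr => h _.
under eq_bigr => w _ do rewrite mulrCA; rewrite sum_eqb.
by case: ifP => _; rewrite ?mulr1 ?mulr0.
Qed.

(** The product of the hook lengths, as [det_tensor_conv] identifies it; in this form it is the
    total weight that normalizes [proj_ker]. *)
Definition hook_const : algC := \sum_a det_tensor a * pol_det delta a rword.

(** Multiplied by the order of the row group it becomes a sum of squares of integers, by
    [pol_det_row_group]; the square at [rword] is nonzero since the row group fixes [rword], where
    [det_tensor] is 1. *)
Lemma hook_const_gt0 : 0 < hook_const.
Proof.
have rg : (0 < #|row_group|)%N.
  by apply/card_gt0P; exists 1%g; apply/row_groupP => i; rewrite perm1.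
have E : #|row_group|%:R * hook_const = \sum_a (\sum_(h in row_group) det_tensor (shift a h)) ^+ 2.
  under [RHS]eq_bigr => a _ do rewrite expr2 big_distrl /=.
  rewrite exchange_big /= -sum1_card natr_sum big_distrl /=; apply: eq_bigr => g rg'.
  rewrite mul1r /hook_const (reindex_inj (@shift_inj _ _ g)) /=; apply: eq_bigr => a _.
  rewrite pol_det_row_group; congr (_ * _).
  rewrite (eq_bigl (mem row_group)) => [|h]; last by rewrite shift_rword_row_group.
  rewrite [RHS](reindex_inj (mulIg g)) /=; apply: eq_big => h; first by rewrite row_groupM.
  by rewrite shiftM.
rewrite -(pmulr_rgt0 _ (x := #|row_group|%:R)) ?ltr0n // E.
rewrite (bigD1 rword) //= ltr_pwDl //.
  rewrite exprn_gt0 // (eq_bigr (fun=> 1)) => [|h].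
    by rewrite sumr_const ltr0n.
  by rewrite -shift_rword_row_group => /eqP <-; rewrite det_tensor_rword.
apply: sumr_ge0 => a _; rewrite real_exprn_even_ge0 // Rreal_int //.
by rewrite rpred_sum // => h _; apply: det_tensor_int.
Qed.

(** A projection onto the covariant tensors, for two reasons: in [v] it is a combination of shifts
    of [det_tensor], hence covariant; and by [proj_ker_span] it is a combination of operators
    A^(tensor d) whose weights det(A)^delta add up to 1 ([proj_ker_weight]), hence it fixes every
    covariant tensor. *)
Definition proj_ker (v w : {ffun 'I_d -> 'I_m}) : algC :=
  hook_const^-1 * \sum_(h : 'S_d) (w == shift rword h)%:R * det_tensor (shift v h^-1).

Lemma proj_ker_span v w :
  proj_ker v w = \sum_(aS : {ffun 'I_d -> 'I_m} * {set 'I_d})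
    (hook_const^-1 * (det_tensor aS.1 * (-1) ^+ #|~: aS.2|)) *
    \prod_p unit_comb aS.1 rword aS.2 (v p) (w p).
Proof.
rewrite -(pair_bigA _ (fun a (S : {set 'I_d}) => (hook_const^-1 * (det_tensor a * (-1) ^+ #|~: S|)) *
    \prod_p unit_comb a rword S (v p) (w p))) /=.
under eq_bigr => a _ do under eq_bigr => S _ do rewrite -!mulrA.
under eq_bigr => a _ do
  rewrite -!big_distrr /= unit_comb_polarize big_distrr /=.
rewrite -big_distrr /= exchange_big /=; congr (_ * _); apply: eq_bigr => h _.
under eq_bigr => a _.
  rewrite mulrCA eq_sym shift_eql; over.
by rewrite /= sum_eqb mulrC.
Qed.

Lemma proj_ker_weight :
  \sum_(aS : {ffun 'I_d -> 'I_m} * {set 'I_d})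
    (hook_const^-1 * (det_tensor aS.1 * (-1) ^+ #|~: aS.2|)) *
    \det (unit_comb aS.1 rword aS.2) ^+ delta = 1.
Proof.
rewrite -(pair_bigA _ (fun a (S : {set 'I_d}) => (hook_const^-1 * (det_tensor a * (-1) ^+ #|~: S|)) *
    \det (unit_comb a rword S) ^+ delta)) /=.
under eq_bigr => a _ do under eq_bigr => S _ do rewrite -!mulrA.
under eq_bigr => a _ do rewrite -!big_distrr /=.
by rewrite -big_distrr /= mulVf // gt_eqF // hook_const_gt0.
Qed.

Lemma covar_proj_ker w : covar delta (proj_ker^~ w).
Proof.
apply: (@eq_covar _ _ _ (fun v => \sum_h (hook_const^-1 * (w == shift rword h)%:R) *
    det_tensor (shift v h^-1))) => [v|].
  by rewrite /proj_ker big_distrr /=; apply: eq_bigr => h _; rewrite mulrA.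
by apply: covar_sum => h _; apply/covar_shift/covar_det_tensor.
Qed.

Lemma proj_ker_shift h v w : proj_ker (shift v h) (shift w h) = proj_ker v w.
Proof.
rewrite /proj_ker (reindex_inj (mulgI h)) /=; congr (_ * _); apply: eq_bigr => g _.
by rewrite -shiftM shift_eq shiftM invMg mulgKV.
Qed.

Definition tableau_char (h : 'S_d) : algC := \sum_v proj_ker v (shift v h).

Lemma tableau_charE h :
  tableau_char h = hook_const^-1 * \sum_(g : 'S_d) det_tensor (shift rword (h^-1 ^ g)).
Proof.
rewrite /tableau_char /proj_ker -big_distrr /= exchange_big /=; congr (_ * _).
apply: eq_bigr => g _; under eq_bigr => v _ do rewrite shift_eql shiftM.
by rewrite sum_eqb shiftM.
Qed.

(* The Young symmetrizer is an idempotent up to the scalar hook_const. *)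
Lemma det_tensor_conv (u : 'S_d) :
  \sum_(h : 'S_d) det_tensor (shift rword h) * det_tensor (shift rword (h^-1 * u))
  = hook_const * det_tensor (shift rword u).
Proof.
rewrite /hook_const big_distrl /=.
under [RHS]eq_bigr => a _ do rewrite -mulrA -(covar_polarize _ _ _ covar_det_tensor) big_distrr /=.
rewrite exchange_big /=; apply: eq_bigr => h _.
under [RHS]eq_bigr => a _.
  rewrite mulrCA eq_sym shift_eql; over.
by rewrite /= sum_eqb mulrC shiftM.
Qed.

End Tableau.

(** * The character of the Specht module *)

Lemma triv_multE (gT : finGroupType) (G : {group gT}) n (rG : mx_representation algC G n) :
  (triv_mult rG)%:R = '[cfRepr rG, 1].
Proof.
rewrite /triv_mult (cfRepr_sim (mx_rsim_standard rG)) cfRepr_standard cfdot_suml.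
rewrite (bigD1 0) //= cfdotZl -irr0 cfdot_irr eqxx mulr1 big1 ?addr0; last first.
  by move=> i /negPf i0; rewrite cfdotZl cfdot_irr i0 mulr0.
by rewrite socle_Iirr0.
Qed.

Lemma mxtrace_submod_idem (gT : finGroupType) (G : {group gT}) n
    (rG : mx_representation algC G n) (U P : 'M_n) (Umod : mxmodule rG U) x :
  x \in G -> P *m P = P -> (P :=: U)%MS -> \tr (submod_repr Umod x) = \tr (P *m rG x).
Proof.
move=> Gx PP PU.
have fixP (W : 'M_n) : (W <= U)%MS -> W *m P = W.
  by rewrite -PU => /submxP[D ->]; rewrite -mulmxA PP.
rewrite -[submod_repr Umod x]mulmxA mxtrace_mulC -val_submodE.
rewrite -[X in \tr X]fixP ?val_submodP // mxtrace_mulC.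
have -> : P *m val_submod (in_submod U (rG x)) = val_submod (in_submod U (P *m rG x)).
  by rewrite /val_submod /in_submod /= !mulmxA.
by rewrite in_submodK // mxmodule_trans // PU.
Qed.

(** The matrix with rows y g is left multiplication by y on the group ring. *)
Lemma mul_rows_gring (gT : finGroupType) (G : {group gT}) (y z : 'rV[algC]_(gcard G)) :
  z *m \matrix_(i < gcard G) (y *m regular_repr algC G (enum_val i))
  = y *m gring_mx (regular_repr algC G) z.
Proof.
rewrite /gring_mx /= [LHS]mulmx_sum_row [z *m _]mulmx_sum_row linear_sum mulmx_sumr.
by apply: eq_bigr => i _; rewrite !rowK linearZ /= -scalemxAr mxvecK.
Qed.

Section IdempotentIdeal.

Variables (gT : finGroupType) (G : {group gT}) (c : 'M[algC]_(gcard G)) (k : algC).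
Local Notation aG := (regular_repr algC G).
Hypotheses (cG : gring_mx aG (gring_row c) = c) (cc : c *m c = k *: c) (k0 : k != 0).

(** Left multiplication by c / k on the group ring: idempotent because c c = k c, with image the
    right ideal generated by c, which is the cyclic module of c. *)
Definition ideal_proj := k^-1 *: \matrix_(i < gcard G) (gring_row c *m aG (enum_val i)).

Lemma row_ideal_proj i : row i ideal_proj = k^-1 *: (gring_row c *m aG (enum_val i)).
Proof. by rewrite /ideal_proj linearZ /= rowK. Qed.

Lemma ideal_proj_idem : ideal_proj *m ideal_proj = ideal_proj.
Proof.
apply/row_matrixP => i; rewrite row_mul row_ideal_proj -scalemxAl; congr (_ *: _).
rewrite /ideal_proj -scalemxAr mul_rows_gring gring_mxJ ?enum_valP // cG.
by rewrite mulmxA -[gring_row c *m c]gring_row_mul cc linearZ /= -scalemxAl scalerA mulVf // scale1r.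
Qed.

Lemma ideal_proj_eqmx : (ideal_proj :=: cyclic_mx aG (gring_row c))%MS.
Proof.
have k1 : k^-1 != 0 by rewrite invr_eq0.
apply: eqmx_trans (eqmx_scale _ k1) _; apply: eqmx_trans _ (eqmx_sym (genmxE _)).
set A := (\matrix_(_ < _) _); set B := (_ *m _).
suff -> : A = B by [].
by apply/row_matrixP => i; rewrite row_mul !rowK mul_rV_lin1 /= mxvecK.
Qed.

Lemma mxtrace_ideal x : x \in G ->
  \tr (submod_repr (cyclic_mx_module aG (gring_row c)) x)
  = k^-1 * \sum_(g in G) gring_row (c *m aG (g * x)%g) 0 (gring_index G g).
Proof.
move=> Gx; rewrite (mxtrace_submod_idem _ Gx ideal_proj_idem ideal_proj_eqmx).
rewrite -scalemxAl linearZ /=; congr (_ * _).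
rewrite /mxtrace (reindex_onto (@gring_index _ G) enum_val) /=; last first.
  by move=> i _; rewrite gring_valK.
apply: eq_big => g; first by apply/eqP/idP => [<-|Gg]; rewrite ?enum_valP ?gring_indexK.
move/eqP => E; have Gg : g \in G by rewrite -E enum_valP.
set M := _ *m _; transitivity (row (gring_index G g) M 0 (gring_index G g)); first by rewrite [RHS]mxE.
by rewrite row_mul rowK E -mulmxA -[regular_mx _ _ g *m _](repr_mxM aG) // -gring_row_mul.
Qed.

End IdempotentIdeal.

Section SpechtChar.

Variables (d m delta : nat) (lambda : seq nat).
Variables (row : 'I_d -> 'I_m) (col : 'I_d -> 'I_delta).
Hypothesis bij : bijective (fun i => (row i, col i)).
Hypothesis rowE : forall i j : 'I_d,
  (reshape_index lambda i == reshape_index lambda j) = (row i == row j).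
Hypothesis colE : forall i j : 'I_d,
  (reshape_offset lambda i == reshape_offset lambda j) = (col i == col j).

Local Notation G := [set: 'S_d]%G.
Local Notation aG := (regular_repr algC G).
Local Notation coef u := (det_tensor row col (shift (rword row) u)).
Local Notation kappa := (hook_const row col).

Let c := \sum_(u : 'S_d) coef u *: aG u.

(** The coefficient of u in the Young symmetrizer is the sum of sgn(q) over the column permutations
    q such that q^-1 u preserves the rows; this is [det_tensor] at [rword] shifted by u. *)
Lemma young_symmetrizerE : young_symmetrizer d lambda = gring_row c.
Proof.
rewrite /young_symmetrizer; congr gring_row.
have -> : row_stab d lambda = row_group row.
  by apply/setP => s; rewrite !inE; apply: eq_forallb => i; rewrite rowE.
have -> : col_stab d lambda = col_group col.
  by apply/setP => s; rewrite !inE; apply: eq_forallb => i; rewrite colE.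
rewrite /c /det_tensor; under [RHS]eq_bigr => u _ do rewrite scaler_suml.
rewrite [RHS]exchange_big /=; apply: eq_bigr => q _.
rewrite (reindex_inj (mulgI q^-1)%g) /= big_mkcond /=. apply: eq_bigr => u _.
rewrite shift_rword_eq mulKVg; case: ifP => _; by rewrite ?mulr1 // mulr0 scale0r.
Qed.

Lemma aGM (g h : 'S_d) : aG g *m aG h = aG (g * h)%g.
Proof. by rewrite repr_mxM ?inE. Qed.

Lemma symmetrizer_idem : c *m c = kappa *: c.
Proof.
rewrite {1}/c mulmx_suml; under eq_bigr => g _ do rewrite /c mulmx_sumr.
under eq_bigr => g _ do rewrite (reindex_inj (mulgI g^-1)%g) /=.
rewrite exchange_big /= /c scaler_sumr; apply: eq_bigr => u _.
rewrite scalerA -(det_tensor_conv bij) scaler_suml; apply: eq_bigr => g _.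
by rewrite -scalemxAl -scalemxAr scalerA aGM mulKVg.
Qed.

Lemma gring_mx_row_c : gring_mx aG (gring_row c) = c.
Proof.
apply: gring_rowK; rewrite /c linear_sum summx_sub // => u _.
by rewrite linearZ scalemx_sub // envelop_mx_id ?inE.
Qed.


Lemma cfRepr_specht h :
  cfRepr (specht_repr d lambda) h = tableau_char row col h.
Proof.
rewrite cfunE inE mulr1n /specht_repr /specht_mx young_symmetrizerE.
rewrite (mxtrace_ideal gring_mx_row_c symmetrizer_idem) ?inE //; last first.
  by rewrite gt_eqF // (hook_const_gt0 bij).
rewrite tableau_charE; congr (_ * _).
rewrite [RHS](reindex_inj invg_inj) /=; apply: eq_big => g; rewrite ?inE // => _.
(* The coefficient of g in c g h comes from the single term u = g h^-1 g^-1. *)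
rewrite /c mulmx_suml linear_sum summxE (bigD1 ((h^-1 ^ g^-1)%g : 'S_d)) //=.
have aE (u v : 'S_d) : gring_row (aG u *m aG v) 0 (gring_index G g) = (g == (u * v)%g)%:R.
  rewrite aGM /gring_row rowK gring_indexK ?inE // mul1g mxE eqxx /=.
  by rewrite -(inj_eq (can_inj (@gring_valK _ G))) !gring_indexK ?inE.
rewrite big1 ?addr0 => [|u nu]; rewrite -scalemxAl linearZ mxE [gring_row _ _ _]aE.
  by rewrite conjgE invgK -!mulgA mulKg mulVg mulg1 eqxx mulr1.
case: eqP => [E|]; last by rewrite mulr0.
by case/eqP: nu; rewrite conjgE invgK -invMg; apply: (canRL (mulgK _)).
Qed.

End SpechtChar.

(** * Dimensions of spaces of covariant tensors *)

Lemma sum_enum_val (R : nmodType) (T : finType) (F : T -> R) :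
  \sum_t F t = \sum_(i < #|T|) F (enum_val i).
Proof. by rewrite -(big_enum_val F). Qed.

Section HasDim.

(** [V] is a bare predicate; the matrix [K] witnesses at once that it is a subspace and what its
    dimension is. *)
Definition has_dim (T : finType) (V : (T -> algC) -> Prop) (k : nat) :=
  exists2 K : 'M[algC]_#|T|, \rank K = k &
    forall f, V f <-> (\row_i f (enum_val i) <= K)%MS.

(** [K] is the kernel of a projection onto [V], whose rank is its trace. The first hypothesis stands
    in for function extensionality. *)
Lemma has_dim_idem (T : finType) (V : (T -> algC) -> Prop) (K : T -> T -> algC) :
  (forall f g, f =1 g -> V f -> V g) ->
  (forall f, V (fun v => \sum_w K v w * f w)) ->
  (forall f v, V f -> \sum_w K v w * f w = f v) ->
  exists2 k, has_dim V k & k%:R = \sum_v K v v.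
Proof.
move=> Vext VK VKf; pose P := \matrix_(i < #|T|, j < #|T|) K (enum_val j) (enum_val i).
have mulP (f : T -> algC) : (\row_i f (enum_val i)) *m P = \row_i (\sum_w K (enum_val i) w * f w).
  apply/rowP => j; rewrite !mxE [RHS]sum_enum_val.
  by apply: eq_bigr => i _; rewrite !mxE mulrC.
have rowV (u : 'rV[algC]_#|T|) : u = \row_i (fun t => u 0 (enum_rank t)) (enum_val i).
  by apply/rowP => j; rewrite mxE enum_valK.
have PP : P *m P = P.
  apply/row_matrixP => i; have := mulP (fun t => row i P 0 (enum_rank t)).
  rewrite -rowV row_mul => ->; apply/rowP => j.
  rewrite !mxE; rewrite (eq_bigr (fun w => K (enum_val j) w * K w (enum_val i))); last first.
    by move=> w _; rewrite !mxE enum_rankK.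
  rewrite (VKf (fun w => K w (enum_val i))) ?enum_valK ?enum_rankK //.
  apply: (Vext (fun v => \sum_w K v w * (w == enum_val i)%:R)) (VK _) => v.
  by under eq_bigr => w _ do rewrite mulrC; rewrite sum_eqb.
exists (\rank P); last first.
  rewrite -mxtrace_idem // /mxtrace [RHS]sum_enum_val.
  by apply: eq_bigr => i _; rewrite mxE.
exists P => // f; split=> [Vf|/submxP[D E]].
  have -> : \row_i f (enum_val i) = (\row_i f (enum_val i)) *m P.
    by rewrite mulP; apply/rowP => j; rewrite !mxE VKf.
  exact: submxMl.
apply: Vext (VK f) => v; have := mulP f.
rewrite {1}E -mulmxA PP -E => /rowP /(_ (enum_rank v)); rewrite !mxE !enum_rankK.
by move=> <-.
Qed.

Variables (T T' : finType) (V : (T -> algC) -> Prop) (V' : (T' -> algC) -> Prop).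

Lemma has_dim_gt0P k : has_dim V k -> (0 < k)%N -> exists2 f, V f & exists t, f t != 0.
Proof.
move=> [K <- KV] k0; have : nz_row K != 0 by rewrite nz_row_eq0 -mxrank_eq0 -lt0n.
case/rV0Pn => j nz; exists (fun t => nz_row K 0 (enum_rank t)).
  apply/KV; apply: submx_trans (nz_row_sub K).
  suff <- : nz_row K = \row_i nz_row K 0 (enum_rank (enum_val i)) by [].
  by apply/rowP => i; rewrite mxE enum_valK.
by exists (enum_val j); rewrite enum_valK.
Qed.

Lemma has_dim_gt0 k f t : has_dim V k -> V f -> f t != 0 -> (0 < k)%N.
Proof.
move=> [K <- KV] /KV fK ft; rewrite lt0n mxrank_eq0; apply: contra_neq ft => K0.
move: fK; rewrite K0 submx0 => /eqP /rowP /(_ (enum_rank t)).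
by rewrite !mxE enum_rankK.
Qed.

Lemma has_dim_le k k' (Phi : T' -> T -> algC) :
  has_dim V k -> has_dim V' k' ->
  (forall f, V f -> V' (fun t' => \sum_t Phi t' t * f t)) ->
  (forall f, V f -> (forall t', \sum_t Phi t' t * f t = 0) -> forall t, f t = 0) ->
  (k <= k')%N.
Proof.
move=> [K <- KV] [K' <- KV'] VV' inj.
pose M := \matrix_(i < #|T|, j < #|T'|) Phi (enum_val j) (enum_val i).
have rowM (u : 'rV[algC]_#|T|) : u *m M = \row_j (\sum_t Phi (enum_val j) t * u 0 (enum_rank t)).
  apply/rowP => j; rewrite !mxE [RHS]sum_enum_val.
  by apply: eq_bigr => i _; rewrite !mxE mulrC enum_valK.
have rowV (u : 'rV[algC]_#|T|) : u = \row_i (fun t => u 0 (enum_rank t)) (enum_val i).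
  by apply/rowP => j; rewrite mxE enum_valK.
rewrite -(mxrank_mul_ker K M) [X in (_ + X)%N](_ : _ = 0%N) ?addn0.
  apply/mxrankS/row_subP => i; rewrite row_mul rowM.
  apply: (iffLR (KV' (fun t' => \sum_t Phi t' t * row i K 0 (enum_rank t)))).
  by apply: VV'; apply/KV; rewrite -rowV row_sub.
apply/eqP; rewrite mxrank_eq0 -submx0; apply/row_subP => i; rewrite submx0.
have := row_sub i (K :&: kermx M)%MS; set u := row i _.
rewrite sub_capmx => /andP[uK /sub_kermxP uM].
apply/eqP/rowP => j; rewrite [RHS]mxE -[j]enum_valK.
apply: (inj (fun t => u 0 (enum_rank t))) => [|t']; first by apply/KV; rewrite -rowV.
by move: uM; rewrite rowM => /rowP /(_ (enum_rank t')); rewrite !mxE enum_rankK.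
Qed.

End HasDim.

Lemma has_dim_le1 (T : finType) (V : (T -> algC) -> Prop) k (phi : T -> algC) :
  has_dim V k ->
  (forall f, V f -> \sum_t phi t * f t = 0 -> forall t, f t = 0) -> (k <= 1)%N.
Proof.
move=> hV inj; apply: (has_dim_le (T' := unit) (V' := fun=> True) (Phi := fun=> phi) hV) => //.
  by exists 1%:M; rewrite ?mxrank1 ?card_unit // => f; rewrite submx1.
by move=> f Vf h; apply: inj => //; apply: h tt.
Qed.

(** The flag selects the symmetric model ([false], trivial character) or the exterior one ([true],
    sign). *)
Definition sgn_char d (s : bool) (h : 'S_d) : algC := (-1) ^+ (s && h).

Lemma sgn_charM d s (g h : 'S_d) : sgn_char s (g * h)%g = sgn_char s g * sgn_char s h.
Proof. by case: s; rewrite /sgn_char /= ?mulr1 // odd_permM signr_addb. Qed.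

Lemma sgn_charV d s (h : 'S_d) : sgn_char s h^-1%g = sgn_char s h.
Proof. by rewrite /sgn_char odd_permV. Qed.

Lemma sgn_char2 d s (h : 'S_d) : sgn_char s h * sgn_char s h = 1.
Proof. by rewrite -expr2 sqrr_sign. Qed.

Section TensorModel.

Variables (I : finType) (d m delta : nat).

Local Notation tword := {ffun 'I_d -> {ffun I -> 'I_m}}.

Definition tcovar (f : tword -> algC) :=
  forall (A : I -> 'M[algC]_m) (v : tword),
    \sum_w f w * \prod_p \prod_i A i (v p i) (w p i) = (\prod_i \det (A i) ^+ delta) * f v.

Definition tsym (s : bool) (f : tword -> algC) :=
  forall (h : 'S_d) (v : tword), f (shift v h) = sgn_char s h * f v.

Definition tinv (s : bool) (f : tword -> algC) := tcovar f /\ tsym s f.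

Definition tcomp (i : I) (v : tword) : {ffun 'I_d -> 'I_m} := [ffun p => v p i].

Lemma tcomp_shift i v h : tcomp i (shift v h) = shift (tcomp i v) h.
Proof. by apply/ffunP => p; rewrite !ffunE. Qed.

Lemma sum_tcomp (F : I -> {ffun 'I_d -> 'I_m} -> algC) :
  \sum_v \prod_i F i (tcomp i v) = \prod_i \sum_u F i u.
Proof.
rewrite bigA_distr_bigA /= (reindex (fun v : tword => [ffun i => tcomp i v])) /=.
  by apply: eq_bigr => v _; apply: eq_bigr => i _; rewrite ffunE.
exists (fun u : {ffun I -> {ffun 'I_d -> 'I_m}} => [ffun p => [ffun i => u i p]]).
  by move=> v _; apply/ffunP => p; apply/ffunP => i; rewrite !ffunE.
by move=> u _; apply/ffunP => i; apply/ffunP => p; rewrite !ffunE.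
Qed.

Lemma eq_tinv s f g : f =1 g -> tinv s f -> tinv s g.
Proof.
move=> fg [cf sf]; split=> [A v|h v]; last by rewrite -!fg sf.
by rewrite -fg -cf; apply: eq_bigr => w _; rewrite fg.
Qed.

Lemma tcovar_sum (J : finType) (c : J -> algC) (f : J -> tword -> algC) :
  (forall j, tcovar (f j)) -> tcovar (fun v => \sum_j c j * f j v).
Proof.
move=> cf A v; rewrite big_distrr /=; under eq_bigr => w _ do rewrite big_distrl /=.
rewrite exchange_big /=; apply: eq_bigr => j _; rewrite mulrCA -cf big_distrr /=.
by apply: eq_bigr => w _; rewrite mulrA.
Qed.

Lemma tcovar_prod (f : I -> {ffun 'I_d -> 'I_m} -> algC) :
  (forall i, covar delta (f i)) -> tcovar (fun v => \prod_i f i (tcomp i v)).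
Proof.
move=> cf A v; rewrite -big_split /=.
under eq_bigr => w _ do rewrite exchange_big /= -big_split /=.
transitivity (\sum_(w : tword) \prod_i (f i (tcomp i w) * \prod_p A i (tcomp i v p) (tcomp i w p))).
  apply: eq_bigr => w _; apply: eq_bigr => i _; congr (_ * _).
  by apply: eq_bigr => p _; rewrite !ffunE.
rewrite (sum_tcomp (fun i w => f i w * \prod_p A i (tcomp i v p) (w p))).
by apply: eq_bigr => i _; apply: cf.
Qed.

Variables (row : 'I_d -> 'I_m) (col : 'I_d -> 'I_delta).
Hypothesis bij : bijective (fun i => (row i, col i)).

Local Notation pk := (proj_ker row col).

(** By [proj_ker_span] in each factor, the operator is a combination of products of A_i^(tensor d).
    Each of these multiplies [f] by its weight, and the weights add up to a product of ones by
    [proj_ker_weight]. *)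
Lemma tcovar_fix f v : tcovar f ->
  \sum_w (\prod_i pk (tcomp i v) (tcomp i w)) * f w = f v.
Proof.
move=> cf; pose J := ({ffun 'I_d -> 'I_m} * {set 'I_d})%type.
pose c (aS : J) := (hook_const row col)^-1 * (det_tensor row col aS.1 * (-1) ^+ #|~: aS.2|).
pose A (aS : J) := unit_comb aS.1 (rword row) aS.2.
have E w : \prod_i pk (tcomp i v) (tcomp i w) = \sum_(k : {ffun I -> J})
    (\prod_i c (k i)) * \prod_p \prod_i A (k i) (v p i) (w p i).
  under eq_bigr => i _ do rewrite proj_ker_span.
  rewrite bigA_distr_bigA /=; apply: eq_bigr => k _; rewrite big_split /=; congr (_ * _).
  rewrite [RHS]exchange_big /=; apply: eq_bigr => i _; apply: eq_bigr => p _.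
  by rewrite !ffunE.
under eq_bigr => w _ do rewrite E big_distrl /=.
rewrite exchange_big /=.
under eq_bigr => k _.
  under eq_bigr => w _ do rewrite -mulrA [_ * f w]mulrC.
  rewrite -big_distrr /= (cf (fun i => A (k i))) mulrA -big_split /=; over.
rewrite /= -big_distrl /= -(bigA_distr_bigA (fun (i : I) aS => c aS * \det (A aS) ^+ delta)) /=.
by rewrite big1 ?mul1r // => i _; apply: (proj_ker_weight bij).
Qed.

(** The projection onto [tinv s] is the product of the [proj_ker] of the factors, averaged over S_d
    against the character [sgn_char s]. Each summand of its trace splits as a product over the
    factors, which gives the power of [tableau_char]. *)
Lemma tinv_dim s : exists2 k, has_dim (tinv s) k &
  k%:R = d`!%:R^-1 * \sum_(h : 'S_d) sgn_char s h * tableau_char row col h ^+ #|I|.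
Proof.
have d0 : d`!%:R != 0 :> algC by rewrite pnatr_eq0 -lt0n fact_gt0.
pose K (v w : tword) := d`!%:R^-1 *
  \sum_(h : 'S_d) sgn_char s h * \prod_i pk (tcomp i v) (shift (tcomp i w) h).
have [|f|f v [cf sf]|k hk kE] := @has_dim_idem tword (tinv s) K.
- exact: eq_tinv.
- have KE v : \sum_w K v w * f w = \sum_(hw : 'S_d * tword)
      (d`!%:R^-1 * sgn_char s hw.1 * f hw.2) * \prod_i pk (tcomp i v) (shift (tcomp i hw.2) hw.1).
    rewrite -(pair_bigA _ (fun h w => (d`!%:R^-1 * sgn_char s h * f w) *
      \prod_i pk (tcomp i v) (shift (tcomp i w) h))).
    rewrite exchange_big /=; apply: eq_bigr => w _; rewrite /K big_distrr big_distrl /=.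
    by apply: eq_bigr => h _; rewrite mulrA mulrAC.
  split.
    have c1 : tcovar (fun v => \sum_(hw : 'S_d * tword)
      (d`!%:R^-1 * sgn_char s hw.1 * f hw.2) * \prod_i pk (tcomp i v) (shift (tcomp i hw.2) hw.1)).
      refine (@tcovar_sum _ (fun hw : 'S_d * tword => d`!%:R^-1 * sgn_char s hw.1 * f hw.2)
        (fun hw v => \prod_i pk (tcomp i v) (shift (tcomp i hw.2) hw.1)) _).
      move=> hw; refine (@tcovar_prod (fun i u => pk u (shift (tcomp i hw.2) hw.1)) _).
      by move=> i; apply: (covar_proj_ker bij).
    by move=> A v; rewrite KE -c1; apply: eq_bigr => w _; rewrite KE.
  move=> g v; rewrite big_distrr /=; apply: eq_bigr => w _; rewrite mulrA; congr (_ * _).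
  rewrite /K mulrCA; congr (_ * _); rewrite (reindex_inj (mulgI g)) /= big_distrr /=.
  apply: eq_bigr => h _; rewrite sgn_charM -mulrA; congr (_ * (_ * _)).
  by apply: eq_bigr => i _; rewrite tcomp_shift -shiftM proj_ker_shift.
- rewrite /K; under eq_bigr => w _ do rewrite -mulrA big_distrl /=.
  rewrite -big_distrr exchange_big /= (eq_bigr (fun=> f v)) => [|h _].
    by rewrite sumr_const card_Sn -[f v *+ _]mulr_natl mulKf.
  rewrite (reindex_inj (@shift_inj _ _ h^-1)) /=.
  under eq_bigr => w _ do rewrite sf sgn_charV mulrACA -mulrA mulrA.
  rewrite -[RHS]mul1r -[X in _ = X * _](sgn_char2 s h) -(tcovar_fix v cf) big_distrr /=.
  apply: eq_bigr => w _; rewrite -!mulrA mulrCA; congr (_ * _); rewrite mulrCA; congr (_ * (_ * _)).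
  by apply: eq_bigr => i _; rewrite -tcomp_shift shiftVK.
exists k => //; rewrite kE -big_distrr exchange_big /=; congr (_ * _); apply: eq_bigr => h _.
rewrite -big_distrr /= (sum_tcomp (fun i u => pk u (shift u h))); congr (_ * _).
by rewrite prodr_const.
Qed.

End TensorModel.

(** * Kronecker coefficients in the symmetric and exterior models *)

Lemma rect_cells m delta : exists2 rc : ('I_(m * delta) -> 'I_m) * ('I_(m * delta) -> 'I_delta),
  bijective (fun i => (rc.1 i, rc.2 i)) &
  (forall i j : 'I_(m * delta),
    (reshape_index (rect m delta) i == reshape_index (rect m delta) j) = (rc.1 i == rc.1 j)) /\
  (forall i j : 'I_(m * delta),
    (reshape_offset (rect m delta) i == reshape_offset (rect m delta) j) = (rc.2 i == rc.2 j)).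
Proof.
have sz : sumn (rect m delta) = (m * delta)%N by rewrite /rect sumn_nseq mulnC.
have ri (i : 'I_(m * delta)) : (reshape_index (rect m delta) i < m)%N.
  by have := @reshape_indexP (rect m delta) i; rewrite sz size_nseq => ->.
have co (i : 'I_(m * delta)) : (reshape_offset (rect m delta) i < delta)%N.
  by have := @reshape_offsetP (rect m delta) i; rewrite sz nth_nseq ri => ->.
exists (fun i => Ordinal (ri i), fun i => Ordinal (co i)) => //=.
apply: inj_card_bij => [i j /=|]; last by rewrite card_prod !card_ord.
move=> [Er Ec]; apply/val_inj => /=.
by rewrite -(reshape_indexK (rect m delta) i) -(reshape_indexK (rect m delta) j) Er Ec.
Qed.

Section Transpose.

Variables (d m delta : nat) (row : 'I_d -> 'I_m) (col : 'I_d -> 'I_delta).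
Hypothesis bij : bijective (fun i => (row i, col i)).

Lemma transpose_bij : bijective (fun i => (col i, row i)).
Proof.
apply: inj_card_bij => [i j [Ec Er]|]; first by apply: (bij_inj bij); rewrite /= Er Ec.
by rewrite (bij_eq_card bij) !card_prod mulnC.
Qed.

(** Inverting u = q p, with q in one stabilizer and p in the other, exchanges their roles, and
    sgn(q) = sgn(u) sgn(p). *)
Lemma det_tensor_transpose (u : 'S_d) :
  det_tensor col row (shift (rword col) u) =
  (-1) ^+ u * det_tensor row col (shift (rword row) u^-1).
Proof.
have gV k (r : 'I_d -> 'I_k) (s : 'S_d) : (s^-1 \in row_group r)%g = (s \in row_group r).
  apply/row_groupP/row_groupP => h i; first by rewrite -(h (s i)) permK.
  by rewrite -[in RHS](permKV s i) h.
rewrite /det_tensor big_distrr /= big_mkcond /= [RHS]big_mkcond /=.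
rewrite [RHS](reindex_inj (mulgI u^-1)%g) /=; apply: eq_bigr => p _.
rewrite !shift_rword_eq invMg invgK mulgK gV -(gV _ col (_ * p)%g) invMg invgK.
rewrite -[_ \in col_group row]/(p \in row_group row) -[_ \in col_group col]/(_ \in row_group col).
rewrite odd_permM odd_permV signr_addb !mulrA -signr_addb addbb mul1r.
by case: ifP => _; case: (_ \in _); rewrite ?mulr1 ?mulr0.
Qed.

Lemma hook_constE :
  hook_const row col = \sum_(h : 'S_d) det_tensor row col (shift (rword row) h)
                       * det_tensor row col (shift (rword row) h^-1).
Proof.
have := det_tensor_conv bij 1; rewrite shift1 (det_tensor_rword bij) mulr1 => <-.
by apply: eq_bigr => h _; rewrite mulg1.
Qed.

End Transpose.

Lemma tableau_char_transpose d m delta (row : 'I_d -> 'I_m) (col : 'I_d -> 'I_delta) h :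
  bijective (fun i => (row i, col i)) ->
  tableau_char col row h = (-1) ^+ h * tableau_char row col h^-1.
Proof.
move=> bij; rewrite !tableau_charE.
have -> : hook_const col row = hook_const row col.
  rewrite (hook_constE (transpose_bij bij)) (hook_constE bij); apply: eq_bigr => g _.
  rewrite !(det_tensor_transpose row col) odd_permV mulrACA -signr_addb addbb mul1r mulrC.
  by rewrite invgK.
rewrite mulrCA; congr (_ * _); rewrite big_distrr /=; apply: eq_bigr => g _.
by rewrite (det_tensor_transpose row col) -conjVg invgK odd_permJ odd_permV.
Qed.

Lemma kroneckerE m delta (row : 'I_(m * delta) -> 'I_m) (col : 'I_(m * delta) -> 'I_delta) :
  bijective (fun i => (row i, col i)) ->
  (forall i j : 'I_(m * delta),
    (reshape_index (rect m delta) i == reshape_index (rect m delta) j) = (row i == row j)) ->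
  (forall i j : 'I_(m * delta),
    (reshape_offset (rect m delta) i == reshape_offset (rect m delta) j) = (col i == col j)) ->
  (krect m delta)%:R =
    (m * delta)`!%:R^-1 * \sum_(h : 'S_(m * delta)) tableau_char row col h ^+ 3 :> algC.
Proof.
move=> bij rowE colE; rewrite /krect /kronecker triv_multE -!cfRepr_prod cfdotE cardsT card_Sn.
congr (_ * _); apply: eq_big => h; rewrite ?inE // => _.
rewrite -(cfRepr_specht bij rowE colE) !cfunE cfun1E inE conjC1 mulr1.
by rewrite !exprS expr0 mulr1 mulrA.
Qed.

(** The equation on [d], instead of the term [m * delta], allows [d] to be m a + m b in
    [krect_add]. *)
Lemma krect_sym d m delta : d = (m * delta)%N ->
  has_dim (@tinv 'I_3 d m delta false) (krect m delta).
Proof.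
move=> ->; have [[row col] /= bij [rowE colE]] := rect_cells m delta.
have [k hk kE] := tinv_dim 'I_3 bij false.
suff -> : krect m delta = k by [].
apply/eqP; rewrite -(eqr_nat algC) (kroneckerE bij rowE colE) kE card_ord.
by apply/eqP; congr (_ * _); apply: eq_bigr => h _; rewrite mul1r.
Qed.

(** Transposing the tableau multiplies each of the three characters by the sign. Three being odd,
    one sign survives, and averaging against it gives the exterior model. *)
Lemma krect_alt d m delta : d = (m * delta)%N ->
  has_dim (@tinv 'I_3 d delta m true) (krect m delta).
Proof.
move=> ->; have [[row col] /= bij [rowE colE]] := rect_cells m delta.
have [k hk kE] := tinv_dim 'I_3 (transpose_bij bij) true.
suff -> : krect m delta = k by [].
apply/eqP; rewrite -(eqr_nat algC) (kroneckerE bij rowE colE) kE card_ord.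
apply/eqP; congr (_ * _); rewrite (reindex_inj invg_inj) /=; apply: eq_bigr => h _.
rewrite (tableau_char_transpose _ bij) exprMn mulrA /sgn_char /= -exprS.
by rewrite (exprM _ 2 2) sqrr_sign expr1n mul1r.
Qed.

(** The right-hand side becomes the norm of the Specht character once its values are known to be
    real. *)
Lemma irr_norm d m delta (row : 'I_d -> 'I_m) (col : 'I_d -> 'I_delta) :
  bijective (fun i => (row i, col i)) ->
  exists2 k, has_dim (@tinv 'I_2 d m delta false) k &
    k%:R = d`!%:R^-1 * \sum_(h : 'S_d) tableau_char row col h ^+ 2.
Proof.
move=> bij; have [k hk kE] := tinv_dim 'I_2 bij false; exists k => //.
by rewrite kE card_ord; congr (_ * _); apply: eq_bigr => h _; rewrite mul1r.
Qed.

(** * The exterior model and the Hodge star *)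

Section TensorPolynomial.

Variables (I : finType) (d m delta : nat).
Local Notation tword := {ffun 'I_d -> {ffun I -> 'I_m}}.

(** Density of invertible matrices along the lines A i + x: both sides are polynomials in x, and the
    determinants are the characteristic polynomials of - A i, hence nonzero. *)
Lemma tcovar_unitmx (f : tword -> algC) :
  (forall (A : I -> 'M[algC]_m) (v : tword), (forall i, \det (A i) != 0) ->
    \sum_w f w * \prod_p \prod_i A i (v p i) (w p i) = (\prod_i \det (A i) ^+ delta) * f v) ->
  tcovar delta f.
Proof.
move=> hf A v; pose Ap i : 'M[{poly algC}]_m := map_mx polyC (A i) + 'X%:M.
pose L := \sum_w (f w)%:P * \prod_p \prod_i Ap i (v p i) (w p i)
          - (\prod_i \det (Ap i) ^+ delta) * (f v)%:P.
have ApE i x : map_mx (horner_eval x) (Ap i) = A i + x%:M.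
  apply/matrixP => a b; rewrite !mxE /= /horner_eval hornerD hornerC; congr (_ + _).
  by rewrite hornerMn hornerX.
have detE i x : (\det (Ap i)).[x] = \det (A i + x%:M).
  by rewrite -ApE det_map_mx.
have LE x : L.[x] = \sum_w f w * \prod_p \prod_i (A i + x%:M) (v p i) (w p i)
    - (\prod_i \det (A i + x%:M) ^+ delta) * f v.
  rewrite hornerD hornerN horner_sum hornerM hornerC horner_prod; congr (_ - _ * _).
    apply: eq_bigr => w _; rewrite hornerM hornerC horner_prod; congr (_ * _).
    apply: eq_bigr => p _; rewrite horner_prod; apply: eq_bigr => i _.
    by rewrite -ApE [in RHS]mxE.
  by apply: eq_bigr => i _; rewrite horner_exp detE.
have q0 : \prod_i \det (Ap i) != 0.
  apply/prodf_neq0 => i _; have -> : Ap i = char_poly_mx (- A i).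
    by rewrite /char_poly_mx /Ap map_mxN opprK addrC.
  exact/monic_neq0/char_poly_monic.
have L0 : L = 0.
  apply: poly_eq0_dense q0 _ => x; rewrite horner_prod => /prodf_neq0 h.
  by rewrite LE hf ?subrr // => i; rewrite -detE h.
move: (LE 0); rewrite L0 horner0 => /esym /eqP; rewrite subr_eq0 => /eqP.
have A0 i : A i + 0%:M = A i by rewrite raddf0 addr0.
move=> E; transitivity (\sum_w f w * \prod_p \prod_i (A i + 0%:M) (v p i) (w p i)).
  apply: eq_bigr => w _; congr (_ * _); apply: eq_bigr => p _; apply: eq_bigr => i _.
  by rewrite A0.
by rewrite E; congr (_ * _); apply: eq_bigr => i _; rewrite A0.
Qed.

Lemma tinv_alt_inj (f : tword -> algC) v : tinv delta true f -> f v != 0 -> injective v.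
Proof.
move=> [_ sf] fv i j vij; apply/eqP; apply: contraNT fv => ij.
have := sf (tperm i j) v; rewrite /sgn_char /= odd_tperm ij expr1 mulN1r.
have -> : shift v (tperm i j) = v.
  by apply/ffunP => p; rewrite ffunE; case: tpermP => // ->.
by move/eqP; rewrite -subr_eq0 opprK -mulr2n mulrn_eq0.
Qed.

End TensorPolynomial.

(** A word in the support of an alternating tensor has m delta distinct letters, out of delta^3. *)
Lemma krect_gt0_leq m delta : (0 < delta)%N -> (0 < krect m delta)%N -> (m <= delta ^ 2)%N.
Proof.
move=> d0 /(has_dim_gt0P (krect_alt (erefl (m * delta)%N))) [f hf [v fv]].
have /leq_card := tinv_alt_inj hf fv.
by rewrite card_ord card_ffun !card_ord expnSr leq_pmul2r.
Qed.

Section DetTensorPower.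

Variables (I : finType) (n N : nat) (tau : 'I_N -> {ffun I -> 'I_n}).
Hypothesis tau_bij : bijective tau.

Definition tensor_mx (A : I -> 'M[algC]_n) : 'M[algC]_N :=
  \matrix_(a, b) \prod_i A i (tau a i) (tau b i).

Lemma tensor_mxM A B : tensor_mx (fun i => A i *m B i) = tensor_mx A *m tensor_mx B.
Proof.
apply/matrixP => a b; rewrite !mxE; under eq_bigr => i _ do rewrite mxE.
rewrite bigA_distr_bigA /= (reindex tau) /=; last exact/onW_bij.
by apply: eq_bigr => c _; rewrite !mxE big_split.
Qed.

(** With one nontrivial factor this is the matrix of [det_block_diag], the restriction of a
    multi-index to the other factors playing the part of the column. *)
Lemma det_tensor_mx1 i (A : 'M[algC]_n) :
  \det (tensor_mx (fun j => if j == i then A else 1%:M)) = \det A ^+ (n ^ #|I|.-1).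
Proof.
pose R := {ffun {j | j != i} -> 'I_n}.
have cR : #|R| = (n ^ #|I|.-1)%N.
  by rewrite card_ffun card_ord card_sig -(cardC1 i).
pose res (t : {ffun I -> 'I_n}) : R := [ffun j => t (val j)].
rewrite -cR -(@det_block_diag _ _ _ _ A (fun a => tau a i) (fun a => enum_rank (res (tau a)))).
  congr (\det _); apply/matrixP => a b; rewrite !mxE (bigD1 i) //= eqxx; congr (_ * _).
  rewrite (inj_eq enum_rank_inj).
  transitivity (\prod_(j | j != i) (tau a j == tau b j)%:R : algC).
    by apply: eq_bigr => j /negPf ->; rewrite mxE.
  case: eqP => [E|/eqP ne].
    rewrite big1 // => j ji; have /ffunP /(_ (exist _ j ji)) := E; rewrite !ffunE /= => ->.
    by rewrite eqxx.
  have /existsP[j nj] : [exists j, res (tau a) j != res (tau b) j].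
    apply: contraR ne; rewrite negb_exists => /forallP h; apply/eqP/ffunP => j.
    by apply/eqP/negPn/h.
  by rewrite (bigD1 (val j)) ?(valP j) //=; move: nj; rewrite !ffunE => /negPf ->; rewrite mul0r.
apply: inj_card_bij => [a b [Ea /enum_rank_inj Eb]|].
  apply: (bij_inj tau_bij); apply/ffunP => j; have [-> | ji] := eqVneq j i; first exact: Ea.
  by have /ffunP /(_ (exist _ j ji)) := Eb; rewrite !ffunE.
rewrite card_prod !card_ord cR -expnS prednK; last by apply/card_gt0P; exists i.
by rewrite -[X in (_ <= X)%N](card_ord N) (bij_eq_card tau_bij) card_ffun card_ord.
Qed.

Lemma det_tensor_mx A : \det (tensor_mx A) = \prod_i \det (A i) ^+ (n ^ #|I|.-1).
Proof.
pose AS (s : seq I) i := if i \in s then A i else 1%:M.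
have tensor_mx_eq B C : B =1 C -> tensor_mx B = tensor_mx C.
  by move=> BC; apply/matrixP => a b; rewrite !mxE; apply: eq_bigr => i _; rewrite BC.
suff H s : uniq s -> \det (tensor_mx (AS s)) = \prod_(i <- s) \det (A i) ^+ (n ^ #|I|.-1).
  rewrite -big_enum /= -H ?enum_uniq //; congr (\det _); apply: tensor_mx_eq => i.
  by rewrite /AS mem_enum.
elim: s => [|i s IH] /= => [_|/andP[iNs us]].
  rewrite big_nil -[RHS](@det1 _ N); congr (\det _); apply/matrixP => a b.
  rewrite !mxE -(inj_eq (bij_inj tau_bij)); under eq_bigr => i _ do rewrite mxE.
  have [->|ne] := eqVneq (tau a) (tau b); first by rewrite big1 // => i _; rewrite eqxx.
  have /existsP[i ni] : [exists i, tau a i != tau b i].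
    apply: contraR ne; rewrite negb_exists => /forallP h; apply/eqP/ffunP => j.
    by apply/eqP/negPn/h.
  by rewrite (bigD1 i) //= (negPf ni) mul0r.
rewrite big_cons -IH // -(det_tensor_mx1 i (A i)) -det_mulmx -tensor_mxM; congr (\det _).
apply: tensor_mx_eq => j; rewrite /AS inE; have [->|ji] := eqVneq j i.
  by rewrite (negPf iNs) mulmx1.
by rewrite mul1mx.
Qed.

End DetTensorPower.

Section CatWords.

Variables (T : finType) (d1 d2 : nat).

Definition catw (w : {ffun 'I_d1 -> T}) (v : {ffun 'I_d2 -> T}) : {ffun 'I_(d1 + d2) -> T} :=
  [ffun k => match split k with inl p => w p | inr q => v q end].

Lemma catwl w v p : catw w v (lshift d2 p) = w p.
Proof. by rewrite ffunE -[lshift _ _]/(unsplit (inl p)) unsplitK. Qed.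

Lemma catwr w v q : catw w v (rshift d1 q) = v q.
Proof. by rewrite ffunE -[rshift _ _]/(unsplit (inr q)) unsplitK. Qed.

Lemma sum_catw (R : nmodType) (F : {ffun 'I_(d1 + d2) -> T} -> R) :
  \sum_u F u = \sum_w \sum_v F (catw w v).
Proof.
rewrite pair_big /= (reindex (fun wv => catw wv.1 wv.2)) //=.
exists (fun u : {ffun 'I_(d1 + d2) -> T} =>
   ([ffun p => u (lshift d2 p)], [ffun q => u (rshift d1 q)])).
  by move=> [w v] _ /=; congr (_, _); apply/ffunP => p; rewrite ffunE ?catwl ?catwr.
move=> u _; apply/ffunP => k; rewrite -(splitK k); case: (split k) => p /=.
  by rewrite catwl ffunE.
by rewrite catwr ffunE.
Qed.

Lemma prod_catw (R : comPzSemiRingType) (F : 'I_(d1 + d2) -> T -> R) w v :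
  \prod_k F k (catw w v k) = (\prod_p F (lshift d2 p) (w p)) * \prod_q F (rshift d1 q) (v q).
Proof.
by rewrite big_split_ord /=; congr (_ * _); apply: eq_bigr => p _; rewrite ?catwl ?catwr.
Qed.

End CatWords.

Section Hodge.

Variables (T : finType) (d1 d2 : nat) (tau : 'I_(d1 + d2) -> T).
Hypothesis tau_bij : bijective tau.

Definition word_mx d (v : {ffun 'I_d -> T}) : 'M[algC]_(d, d1 + d2) :=
  \matrix_(i, j) (v i == tau j)%:R.

(** The Levi-Civita symbol of the concatenated word w v with respect to the numbering [tau]: summing
    it against f(w) is the Hodge star. Written as a determinant, it inherits multiplicativity. *)
Definition hodge_ker (v : {ffun 'I_d2 -> T}) (w : {ffun 'I_d1 -> T}) : algC :=
  \det (word_mx (catw w v)).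

Lemma word_mx_cat (w : {ffun 'I_d1 -> T}) (v : {ffun 'I_d2 -> T}) :
  word_mx (catw w v) = col_mx (word_mx w) (word_mx v).
Proof.
apply/matrixP => i j; rewrite -[i]splitK; case: (split i) => p /=.
  by rewrite col_mxEu !mxE catwl.
by rewrite col_mxEd !mxE catwr.
Qed.

Lemma word_mx_shift d (v : {ffun 'I_d -> T}) h : word_mx (shift v h) = perm_mx h *m word_mx v.
Proof. by rewrite -row_permE; apply/matrixP => i j; rewrite !mxE ffunE. Qed.

Lemma hodge_ker_shiftl v w h : hodge_ker (shift v h) w = (-1) ^+ h * hodge_ker v w.
Proof.
rewrite /hodge_ker !word_mx_cat word_mx_shift.
have -> : col_mx (word_mx w) (perm_mx h *m word_mx v) =
    block_mx 1%:M 0 0 (perm_mx h) *m col_mx (word_mx w) (word_mx v).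
  by rewrite mul_block_col !mul0mx mul1mx addr0 add0r.
by rewrite det_mulmx det_ublock det1 mul1r det_perm.
Qed.

Lemma hodge_ker_shiftr v w h : hodge_ker v (shift w h) = (-1) ^+ h * hodge_ker v w.
Proof.
rewrite /hodge_ker !word_mx_cat word_mx_shift.
have -> : col_mx (perm_mx h *m word_mx w) (word_mx v) =
    block_mx (perm_mx h) 0 0 1%:M *m col_mx (word_mx w) (word_mx v).
  by rewrite mul_block_col !mul0mx mul1mx addr0 add0r.
by rewrite det_mulmx det_ublock det1 mulr1 det_perm.
Qed.

Lemma sum_det_word_mx (Y : 'I_(d1 + d2) -> T -> algC) :
  \sum_(u : {ffun 'I_(d1 + d2) -> T}) \det (word_mx u) * \prod_k Y k (u k)
  = \det (\matrix_(k, b) Y k (tau b)).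
Proof.
have detE (u : {ffun 'I_(d1 + d2) -> T}) :
    \det (word_mx u) = \sum_(s : 'S_(d1 + d2)) (-1) ^+ s * (u == [ffun k => tau (s k)])%:R.
  apply: eq_bigr => s _; congr (_ * _); rewrite -prod_eqb; apply: eq_bigr => k _.
  by rewrite mxE ffunE.
under eq_bigr => u _ do rewrite detE big_distrl /=.
rewrite exchange_big /=; apply: eq_bigr => s _.
under eq_bigr => u _ do rewrite -mulrA.
rewrite -big_distrr /= sum_eqb; congr (_ * _).
by apply: eq_bigr => k _; rewrite mxE ffunE.
Qed.

(** The top exterior power: a matrix acting on every letter multiplies the Levi-Civita symbol by its
    determinant. *)
Lemma hodge_ker_mul (M : T -> T -> algC) (v' : {ffun 'I_d2 -> T}) (w' : {ffun 'I_d1 -> T}) :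
  \sum_v \sum_w hodge_ker v w * ((\prod_p M (w p) (w' p)) * \prod_q M (v q) (v' q))
  = \det (\matrix_(a, b) M (tau a) (tau b)) * hodge_ker v' w'.
Proof.
rewrite exchange_big /=.
transitivity (\sum_(u : {ffun 'I_(d1 + d2) -> T}) \det (word_mx u) *
    \prod_k M (u k) (catw w' v' k)).
  rewrite sum_catw; apply: eq_bigr => w _; apply: eq_bigr => v _; congr (_ * _).
  rewrite (prod_catw (fun k t => M t (catw w' v' k))); congr (_ * _); apply: eq_bigr => p _.
    by rewrite catwl.
  by rewrite catwr.
rewrite (sum_det_word_mx (fun k t => M t (catw w' v' k))) mulrC.
rewrite -[X in _ = _ * X]det_tr /hodge_ker -det_mulmx; congr (\det _).
apply/matrixP => k b; rewrite !mxE.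
have [g gK Kg] := tau_bij; rewrite (bigD1 (g (catw w' v' k))) //= big1 => [|c nc].
  by rewrite !mxE Kg eqxx mul1r addr0.
rewrite !mxE; case: eqP => [E|]; last by rewrite mul0r.
by case/eqP: nc; rewrite E gK.
Qed.

Lemma hodge_ker_neq0 v w : (hodge_ker v w != 0) = injectiveb (catw w v).
Proof.
apply/idP/idP => [h|/injectiveP h].
  apply: contraR h => /injectivePn[i [j ij wij]].
  by apply/eqP/(determinant_alternate ij) => k; rewrite !mxE wij.
have : \det (word_mx (catw w v) *m (word_mx (catw w v))^T) != 0.
  have -> : word_mx (catw w v) *m (word_mx (catw w v))^T = 1%:M.
    have [g gK Kg] := tau_bij; apply/matrixP => i j; rewrite !mxE (bigD1 (g (catw w v i))) //=.
    rewrite big1 => [|c nc]; rewrite !mxE; last first.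
      by case: eqP => [E|]; rewrite ?mul0r //; case/eqP: nc; rewrite E gK.
    by rewrite Kg eqxx mul1r addr0 eq_sym (inj_eq h).
  by rewrite det1 oner_eq0.
by rewrite det_mulmx mulf_eq0 negb_or => /andP[].
Qed.

Lemma hodge_ker_compl (w : {ffun 'I_d1 -> T}) : injective w -> exists v, hodge_ker v w != 0.
Proof.
move=> winj; have cT : #|T| = (d1 + d2)%N by rewrite -(bij_eq_card tau_bij) card_ord.
have c2 : d2 = #|[predC codom w]|.
  by apply/eqP; rewrite -(eqn_add2l d1) -cT -(cardC (mem (codom w))) (card_codom winj) card_ord.
exists [ffun q => enum_val (cast_ord c2 q)]; rewrite hodge_ker_neq0; apply/injectiveP.
move=> i j; rewrite -[i]splitK -[j]splitK.
have ne p q : w p <> enum_val (cast_ord c2 q).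
  by move=> E; have := enum_valP (cast_ord c2 q); rewrite inE -E codom_f.
case: (split i) => p; case: (split j) => q /=; rewrite ?catwl ?catwr ?ffunE.
- by move=> /winj ->.
- by move=> /ne.
- by move=> /esym /ne.
- by move=> /enum_val_inj /cast_ord_inj ->.
Qed.

(** If f(w) is nonzero, complete [w] by some [v] to all of [T]. The words w' with a nonzero symbol
    against [v] are the rearrangements of [w], and all contribute the same term since the two signs
    cancel; so the sum at [v] is a positive multiple of a nonzero number. *)
Lemma hodge_ker_inj (f : {ffun 'I_d1 -> T} -> algC) :
  (forall h w, f (shift w h) = (-1) ^+ h * f w) ->
  (forall w, f w != 0 -> injective w) ->
  (forall v, \sum_w hodge_ker v w * f w = 0) -> forall w, f w = 0.
Proof.
move=> sf finj g0 w; apply/eqP/negPn/negP => fw.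
have [v ev] := hodge_ker_compl (finj _ fw).
have same w' : hodge_ker v w' != 0 -> hodge_ker v w' * f w' = hodge_ker v w * f w.
  rewrite hodge_ker_neq0 => /injectiveP inj'.
  have /injectiveP inj : injectiveb (catw w v) by rewrite -hodge_ker_neq0.
  have cd : #|'I_(d1 + d2)| = #|T| := bij_eq_card tau_bij.
  have [k Kk kK] := inj_card_bij inj (eq_leq (esym cd)).
  have ex p : exists q, w q == w' p.
    have := kK (w' p); rewrite -{1}[k _]splitK; case: (split _) => q /=.
      by rewrite catwl => <-; exists q.
    rewrite catwr -(catwr w' v q) -(catwl w' v p) => /inj' /(congr1 val) /= E.
    by have := ltn_ord p; rewrite -E ltnNge leq_addr.
  pose h0 p := xchoose (ex p).
  have h0E p : w (h0 p) = w' p by apply/eqP/(xchooseP (ex p)).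
  have h0inj : injective h0.
    move=> p q E; have : w' p = w' q by rewrite -!h0E E.
    by rewrite -(catwl w' v p) -(catwl w' v q) => /inj' /lshift_inj.
  have -> : w' = shift w (perm h0inj) by apply/ffunP => p; rewrite !ffunE permE h0E.
  by rewrite hodge_ker_shiftr sf mulrACA -signr_addb addbb mul1r.
have := g0 v; rewrite (bigID (fun w' => hodge_ker v w' != 0)) /= [X in _ + X]big1 ?addr0.
  rewrite (eq_bigr (fun=> hodge_ker v w * f w)) //; rewrite sumr_const => /eqP.
  rewrite mulrn_eq0 mulf_eq0 (negPf ev) (negPf fw) !orbF => /eqP /card0_eq /(_ w).
  by rewrite unfold_in /= ev.
by move=> w' /negPn /eqP ->; rewrite mul0r.
Qed.

End Hodge.

(** The Hodge star between the exterior models of the a x n and b x n rectangles. With P the product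
    of the det(A i), the tensor product of the A i has determinant P^(n^2); as [f] has weight P^a,
    its star has weight P^(n^2 - a) = P^b. *)
Lemma krect_compl_le n a b : (a + b = n ^ 2)%N -> (krect a n <= krect b n)%N.
Proof.
move=> abn; pose T : finType := {ffun 'I_3 -> 'I_n}.
have NE : (a * n + b * n)%N = #|T| by rewrite -mulnDl abn card_ffun !card_ord -expnSr.
pose tau (i : 'I_(a * n + b * n)) : T := enum_val (cast_ord NE i).
have tau_bij : bijective tau.
  by apply: bij_comp; [exact: enum_val_bij |
    exists (cast_ord (esym NE)); [exact: cast_ordK | exact: cast_ordKV]].
apply: (has_dim_le (Phi := hodge_ker tau) (krect_alt (erefl (a * n)%N)) (krect_alt (erefl (b * n)%N))).
  move=> f [cf sf]; split; last first.
    move=> h v; rewrite big_distrr /=; apply: eq_bigr => w _.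
    by rewrite hodge_ker_shiftl mulrA.
  (* The weight P^a of [f] has to be cancelled, hence the restriction to invertible matrices. *)
  apply: tcovar_unitmx => A v' A0.
  pose M (t t' : T) := \prod_i (A i)^T (t i) (t' i).
  pose P := \prod_i \det (A i).
  have PE k : \prod_i \det (A i) ^+ k = P ^+ k by rewrite prodrXl.
  have P0 : P ^+ a != 0 by rewrite expf_neq0 //; apply/prodf_neq0 => i _.
  have ME : \det (\matrix_(x, y) M (tau x) (tau y)) = P ^+ (n ^ 2).
    have -> : \matrix_(x, y) M (tau x) (tau y) = tensor_mx tau (fun i => (A i)^T) by [].
    rewrite (det_tensor_mx tau_bij) card_ord /= -PE; apply: eq_bigr => i _; by rewrite det_tr.
  have cfT w : P ^+ a * f w = \sum_w' f w' * \prod_p M (w p) (w' p).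
    by rewrite (cf (fun i => (A i)^T)) -PE; congr (_ * _); apply: eq_bigr => i _; rewrite det_tr.
  apply: (mulfI P0); rewrite PE mulrA -exprD abn -ME.
  (* A triple sum evaluated in two ways: over v and w first it is [hodge_ker_mul], over w' first it
     is the covariance of [f]. *)
  transitivity (\sum_w' f w' * \sum_v \sum_w hodge_ker tau v w *
      ((\prod_p M (w p) (w' p)) * \prod_q M (v q) (v' q))); last first.
    rewrite big_distrr /=; apply: eq_bigr => w' _.
    by rewrite (hodge_ker_mul tau_bij) mulrC -!mulrA.
  under [RHS]eq_bigr => w' _ do rewrite big_distrr /=.
  rewrite [RHS]exchange_big [LHS]big_distrr. apply: eq_bigr => v _; rewrite [LHS]/=.
  under [RHS]eq_bigr => w' _ do rewrite big_distrr /=.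
  rewrite [RHS]exchange_big big_distrl [LHS]big_distrr; apply: eq_bigr => w _; rewrite [LHS]/=.
  rewrite mulrA mulrCA cfT mulr_sumr mulr_suml; apply: eq_bigr => w' _.
  rewrite [RHS]mulrCA -!mulrA; congr (_ * (_ * (_ * _))).
  by apply: eq_bigr => q _; apply: eq_bigr => i _; rewrite mxE.
move=> f [cf sf] g0; apply: (hodge_ker_inj tau_bij) g0 => [h w|w]; first exact: sf.
by apply: tinv_alt_inj; split; [exact: cf | exact: sf].
Qed.

Lemma krect_compl n j : (j <= n ^ 2)%N -> krect (n ^ 2 - j) n = krect j n.
Proof.
by move=> jn; apply/eqP; rewrite eqn_leq !krect_compl_le ?subnK ?subnKC.
Qed.

(** * The symmetric model and polynomial functions *)

Section PolynomialFunctions.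

Variables (T : finType) (d : nat).
Local Notation tword := {ffun 'I_d -> T}.

Definition tev (f : tword -> algC) (X : T -> algC) : algC := \sum_w f w * \prod_p X (w p).

Lemma eq_tev f X Y : X =1 Y -> tev f X = tev f Y.
Proof.
by move=> XY; apply: eq_bigr => w _; congr (_ * _); apply: eq_bigr => p _; rewrite XY.
Qed.

(** Polarization again: for symmetric [f], the signed sum of the values of the polynomial at sums of
    the basis vectors [v j], j in S, is d! f(v). *)
Lemma tev_neq0 (f : tword -> algC) v :
  (forall (h : 'S_d) v, f (shift v h) = f v) -> f v != 0 -> exists X, tev f X != 0.
Proof.
move=> sf fv; pose X (S : {set 'I_d}) t : algC := \sum_(j in S) (t == v j)%:R.
suff /existsP[S nS] : [exists S, tev f (X S) != 0] by exists (X S).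
apply: contraNT fv; rewrite negb_exists => /forallP f0.
have E : \sum_(S : {set 'I_d}) (-1) ^+ #|~: S| * tev f (fun t => \sum_(j in S) (t == v j)%:R)
    = d`!%:R * f v.
  under eq_bigr => S _ do rewrite /tev big_distrr /=.
  rewrite exchange_big /=; under eq_bigr => w _.
    under eq_bigr => S _ do rewrite mulrCA.
    rewrite -big_distrr /= (ryser (fun p j => (w p == v j)%:R)) big_distrr /=; over.
  rewrite exchange_big /= (eq_bigr (fun=> f v)) => [|h _].
    by rewrite sumr_const card_Sn mulr_natl.
  under eq_bigr => w _.
    rewrite (_ : \prod_p _ = (w == shift v h)%:R) 1?mulrC; last first.
      by rewrite -prod_eqb; apply: eq_bigr => p _; rewrite ffunE.
    over.
  by rewrite /= sum_eqb sf.
move: E; rewrite big1 => [/esym/eqP|S _]; last by rewrite (eqP (negbNE (f0 S))) mulr0.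
rewrite mulf_eq0 pnatr_eq0 => /orP[/eqP d0|//].
by have := fact_gt0 d; rewrite d0.
Qed.

Lemma tev_inj (f : tword -> algC) :
  (forall (h : 'S_d) v, f (shift v h) = f v) -> (forall X, tev f X = 0) -> forall v, f v = 0.
Proof. by move=> sf f0 v; apply/eqP/negPn/negP => /(tev_neq0 sf)[X]; rewrite f0 eqxx. Qed.

Lemma tev_line f X D : exists p : {poly algC}, forall t, p.[t] = tev f (fun x => X x + t * D x).
Proof.
exists (\sum_w (f w)%:P * \prod_p ((X (w p))%:P + 'X * (D (w p))%:P)) => t.
rewrite horner_sum; apply: eq_bigr => w _; rewrite hornerM hornerC horner_prod; congr (_ * _).
by apply: eq_bigr => p _; rewrite hornerD hornerM hornerX !hornerC.
Qed.

End PolynomialFunctions.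

(** On the line from [X1] to [X2] both forms restrict to nonzero polynomials, the first because of
    its value at 0, the second because of its value at 1. *)
Lemma tev_common_neq0 (T : finType) d1 d2 (f1 : {ffun 'I_d1 -> T} -> algC)
    (f2 : {ffun 'I_d2 -> T} -> algC) X1 X2 :
  tev f1 X1 != 0 -> tev f2 X2 != 0 -> exists X, tev f1 X * tev f2 X != 0.
Proof.
move=> n1 n2; have [p1 E1] := tev_line f1 X1 (fun x => X2 x - X1 x).
have [p2 E2] := tev_line f2 X1 (fun x => X2 x - X1 x).
have : p1 * p2 != 0.
  rewrite mulf_eq0 negb_or; apply/andP; split.
    apply: contraNneq n1 => p0; move: (E1 0); rewrite p0 horner0 => ->.
    by apply/eqP/eq_tev => x; rewrite mul0r addr0.
  apply: contraNneq n2 => p0; move: (E2 1); rewrite p0 horner0 => ->.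
  by apply/eqP/eq_tev => x; rewrite mul1r addrC subrK.
case/poly_nonroot => x; rewrite hornerM E1 E2 => h.
by exists (fun y => X1 y + x * (X2 y - X1 y)).
Qed.

Section SymModel.

Variables (I : finType) (m : nat).
Local Notation T := {ffun I -> 'I_m}.

Definition tact (A : I -> 'M[algC]_m) (X : T -> algC) (t' : T) :=
  \sum_t X t * \prod_i A i (t i) (t' i).

Lemma tev_tact d delta (f : {ffun 'I_d -> T} -> algC) A X : tcovar delta f ->
  tev f (tact A X) = (\prod_i \det (A i) ^+ delta) * tev f X.
Proof.
move=> cf; rewrite /tev /tact big_distrr /=.
under [RHS]eq_bigr => v _ do rewrite mulrA -cf big_distrl /=.
rewrite [RHS]exchange_big /=; apply: eq_bigr => w _.
rewrite bigA_distr_bigA big_distrr /=; apply: eq_bigr => v _.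
by rewrite big_split /= mulrA mulrAC.
Qed.

Definition symprod d1 d2 (f1 : {ffun 'I_d1 -> T} -> algC) (f2 : {ffun 'I_d2 -> T} -> algC)
    (u : {ffun 'I_(d1 + d2) -> T}) : algC :=
  \sum_(h : 'S_(d1 + d2)) f1 [ffun p => u (h (lshift d2 p))] * f2 [ffun q => u (h (rshift d1 q))].


Lemma tev_symprod d1 d2 (f1 : {ffun 'I_d1 -> T} -> algC) (f2 : {ffun 'I_d2 -> T} -> algC) X :
  tev (symprod f1 f2) X = (d1 + d2)`!%:R * (tev f1 X * tev f2 X).
Proof.
rewrite /tev /symprod; under eq_bigr => u _ do rewrite big_distrl /=.
rewrite exchange_big /= (eq_bigr (fun=> tev f1 X * tev f2 X)) => [|h _].
  by rewrite sumr_const card_Sn mulr_natl.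
rewrite (reindex_inj (@shift_inj _ _ h^-1)) /= sum_catw /tev big_distrlr /=.
apply: eq_bigr => w _; apply: eq_bigr => v _; rewrite mulrACA; congr (_ * _).
  congr (f1 _ * f2 _); apply/ffunP => p; rewrite !ffunE permK.
    by have := catwl w v p; rewrite ffunE.
  by have := catwr w v p; rewrite ffunE.
transitivity (\prod_k X (catw w v k)); last exact: prod_catw (fun k t => X t) w v.
by rewrite (reindex_perm h) /=; apply: eq_bigr => k _; rewrite ffunE permK.
Qed.

Lemma tinv_symprod d1 d2 delta1 delta2 (f1 : {ffun 'I_d1 -> T} -> algC)
    (f2 : {ffun 'I_d2 -> T} -> algC) :
  tinv delta1 false f1 -> tinv delta2 false f2 -> tinv (delta1 + delta2) false (symprod f1 f2).
Proof.
move=> [c1 s1] [c2 s2]; split=> [A v|g v]; last first.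
  rewrite mul1r /symprod (reindex_inj (mulIg g^-1)%g) /=; apply: eq_bigr => h _.
  by congr (f1 _ * f2 _); apply/ffunP => p; rewrite !ffunE permM permKV.
rewrite /symprod big_distrr /=; under eq_bigr => u _ do rewrite big_distrl /=.
rewrite exchange_big /=; apply: eq_bigr => h _.
rewrite (reindex_inj (@shift_inj _ _ h^-1)) /= sum_catw.
under [X in X * _]eq_bigr => i _ do rewrite exprD.
rewrite big_split /= mulrACA -c1 -c2 big_distrlr /=.
apply: eq_bigr => w _; apply: eq_bigr => w' _; rewrite mulrACA; congr (_ * _).
  congr (f1 _ * f2 _); apply/ffunP => p; rewrite !ffunE permK.
    by have := catwl w w' p; rewrite ffunE.
  by have := catwr w w' p; rewrite ffunE.
rewrite (reindex_perm h) /=.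
under eq_bigr => k _ do rewrite ffunE permK.
rewrite (prod_catw (fun k (t : T) => \prod_i A i (v (h k) i) (t i)) w w').
by congr (_ * _); apply: eq_bigr => p _; rewrite ffunE.
Qed.

End SymModel.

Lemma krect_add m a b : (0 < krect m a)%N -> (0 < krect m b)%N -> (0 < krect m (a + b))%N.
Proof.
move=> /(has_dim_gt0P (krect_sym (erefl (m * a)%N)))[f1 hf1 [v1 n1]].
move=> /(has_dim_gt0P (krect_sym (erefl (m * b)%N)))[f2 hf2 [v2 n2]].
have sf d delta (f : {ffun 'I_d -> {ffun 'I_3 -> 'I_m}} -> algC) : tinv delta false f ->
    forall h v, f (shift v h) = f v.
  by move=> [_ sf] h v; rewrite sf mul1r.
have [X1 nX1] := tev_neq0 (sf _ _ _ hf1) n1; have [X2 nX2] := tev_neq0 (sf _ _ _ hf2) n2.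
have [X nX] := tev_common_neq0 nX1 nX2.
have /existsP[v nv] : [exists v, symprod f1 f2 v != 0].
  apply: contraR nX; rewrite negb_exists => /forallP h.
  have : tev (symprod f1 f2) X = 0.
    by rewrite /tev big1 // => v _; rewrite (eqP (negbNE (h v))) mul0r.
  rewrite tev_symprod => /eqP; rewrite mulf_eq0 pnatr_eq0 => /orP[/eqP d0|//].
  by have := fact_gt0 (m * a + m * b); rewrite d0.
exact: has_dim_gt0 (krect_sym (esym (mulnDr m a b))) (tinv_symprod hf1 hf2) nv.
Qed.

Section Pairs.

Variables (d m delta : nat).
Local Notation T := {ffun 'I_2 -> 'I_m}.

Lemma sum_ffun2 (R : nmodType) (F : T -> R) :
  \sum_t F t = \sum_a \sum_b F [ffun i => if i == ord0 then a else b].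
Proof.
rewrite pair_big /= (reindex (fun ab : 'I_m * 'I_m =>
  [ffun i : 'I_2 => if i == ord0 then ab.1 else ab.2])) //=.
exists (fun t : T => (t ord0, t (lift ord0 ord0))) => [[a b] _|t _] /=; first by rewrite !ffunE.
by apply/ffunP => i; rewrite ffunE; case: (unliftP ord0 i) => [j|] -> //=; rewrite (ord1 j).
Qed.

(* An invariant F of pairs of vectors is a function on m x m matrices
   with F(A X B) = (det A det B)^delta F(X), hence F(X) = det(X)^delta F(1). *)
Lemma tinv_pair_le1 k : has_dim (@tinv 'I_2 d m delta false) k -> (k <= 1)%N.
Proof.
move=> hk; pose E (t : T) : algC := (t ord0 == t (lift ord0 ord0))%:R.
refine (has_dim_le1 (phi := fun v : {ffun 'I_d -> T} => \prod_p E (v p)) hk _) => f [cf sf] f0.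
apply: tev_inj => [h v|X]; first by rewrite sf mul1r.
pose M : 'M[algC]_m := \matrix_(a, b) X [ffun i => if i == ord0 then a else b].
pose A (i : 'I_2) : 'M[algC]_m := if i == ord0 then 1%:M else M.
(* Any matrix, singular or not, is the image of the identity matrix [E] under (1, M). *)
have -> : tev f X = tev f (tact A E).
  apply: eq_tev => t; rewrite /tact sum_ffun2.
  rewrite (bigD1 (t ord0)) //= [X in _ + X]big1 ?addr0 => [|a na]; last first.
    rewrite big1 // => b _; rewrite big_ord_recl big_ord1 !ffunE /= /A /= mxE.
    by rewrite (negPf na) mul0r mulr0.
  rewrite (bigD1 (t ord0)) //= [X in _ + X]big1 ?addr0 => [|b nb]; last first.
    by rewrite /E !ffunE /= eq_sym (negPf nb) mul0r.
  rewrite /E !ffunE /= eqxx mul1r big_ord_recl big_ord1 !ffunE /= /A /= !mxE eqxx mul1r.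
  congr X; apply/ffunP => i; rewrite ffunE; case: (unliftP ord0 i) => [j|] -> //=.
  by rewrite (ord1 j).
rewrite (tev_tact _ _ cf) (_ : tev f E = 0) ?mulr0 //.
by rewrite -[RHS]f0; apply: eq_bigr => w _; rewrite mulrC.
Qed.

End Pairs.

(** * Pencils of 2 x 2 matrices: forms vanishing at the unit tensor *)

Section BinaryTensors.

Variables (d delta : nat).
Local Notation T := {ffun 'I_3 -> 'I_2}.
Let i1 : 'I_3 := lift ord0 ord0.
Let i2 : 'I_3 := lift ord0 (lift ord0 ord0).
Let e0 : 'I_2 := ord0.
Let e1 : 'I_2 := lift ord0 ord0.

Definition triple (a b c : 'I_2) : T :=
  [ffun i => if i == ord0 then a else if i == i1 then b else c].

Lemma ord3P (P : 'I_3 -> Prop) : P ord0 -> P i1 -> P i2 -> forall i, P i.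
Proof.
move=> P0 P1 P2 i; case: (unliftP ord0 i) => [j|] -> //.
by case: (unliftP ord0 j) => [k|] -> //; rewrite (ord1 k).
Qed.

Lemma sum_triple (R : nmodType) (F : T -> R) :
  \sum_t F t = \sum_a \sum_b \sum_c F (triple a b c).
Proof.
rewrite pair_big pair_big /= (reindex (fun x : 'I_2 * 'I_2 * 'I_2 => triple x.1.1 x.1.2 x.2)) //=.
exists (fun t : T => (t ord0, t i1, t i2)) => [[[a b] c] _|t _] /=; first by rewrite !ffunE.
by apply/ffunP; apply: ord3P; rewrite !ffunE.
Qed.

Definition slices (Z : 'I_2 -> 'M[algC]_2) (t : T) : algC := Z (t ord0) (t i1) (t i2).

Lemma tact_slices (A0 A1 A2 : 'M[algC]_2) Z :
  tact (fun i => if i == ord0 then A0 else if i == i1 then A1 else A2) (slices Z) =1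
  slices (fun s => A1^T *m (\sum_k A0 k s *: Z k) *m A2).
Proof.
move=> t; rewrite /tact sum_triple /slices !mxE.
transitivity (\sum_c \sum_b \sum_a Z a b c * (A0 a (t ord0) * (A1 b (t i1) * A2 c (t i2)))).
  rewrite exchange_big /=; under eq_bigr => b _ do rewrite exchange_big /=.
  rewrite exchange_big /=; apply: eq_bigr => c _; apply: eq_bigr => b _; apply: eq_bigr => a _.
  by rewrite !big_ord_recl big_ord0 mulr1 !ffunE.
apply: eq_bigr => c _; rewrite !mxE big_distrl /=; apply: eq_bigr => b _.
rewrite summxE !mxE mulrAC big_distrr /=; apply: eq_bigr => a _.
by rewrite !mxE; ring.
Qed.

Variable f : {ffun 'I_d -> T} -> algC.
Hypothesis cf : tcovar delta f.

Definition vanish (Z : 'I_2 -> 'M[algC]_2) := tev f (slices Z) = 0.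

Lemma vanish_act (A0 A1 A2 : 'M[algC]_2) (Z Z' : 'I_2 -> 'M[algC]_2) :
  (forall s, Z' s = A1^T *m (\sum_k A0 k s *: Z k) *m A2) -> vanish Z -> vanish Z'.
Proof.
rewrite /vanish => ZE Z0; pose A (i : 'I_3) := if i == ord0 then A0 else if i == i1 then A1 else A2.
have <- : tev f (tact A (slices Z)) = tev f (slices Z').
  by apply: eq_tev => t; rewrite tact_slices /slices -ZE.
by rewrite (tev_tact _ _ cf) Z0 mulr0.
Qed.

(** Zariski closure along a line: Z may be perturbed in the direction D, away from finitely many
    values of x. *)
Lemma vanish_line (Z D : 'I_2 -> 'M[algC]_2) (q : {poly algC}) : q != 0 ->
  (forall x, q.[x] != 0 -> vanish (fun s => Z s + x *: D s)) -> vanish Z.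
Proof.
move=> q0 h; have [p pE] := tev_line f (slices Z) (slices D).
have p0 : p = 0.
  apply: poly_eq0_dense q0 _ => x /h; rewrite /vanish pE => <-.
  by apply: eq_tev => t; rewrite /slices !mxE.
move: (pE 0); rewrite p0 horner0 => /esym E; rewrite /vanish -[RHS]E.
by apply: eq_tev => t; rewrite mul0r addr0.
Qed.

Hypothesis unit_vanish : vanish (fun s => delta_mx s s).

Lemma mx2P (A B : 'M[algC]_2) : A e0 e0 = B e0 e0 -> A e0 e1 = B e0 e1 ->
  A e1 e0 = B e1 e0 -> A e1 e1 = B e1 e1 -> A = B.
Proof.
have P2 (Q : 'I_2 -> Prop) : Q e0 -> Q e1 -> forall i, Q i.
  by move=> Q0 Q1 i; case: (unliftP ord0 i) => [j|] -> //; rewrite (ord1 j).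
by move=> E1 E2 E3 E4; apply/matrixP; apply: (P2); apply: (P2).
Qed.

Lemma sum_ord2 (V : nmodType) (F : 'I_2 -> V) : \sum_k F k = F e0 + F e1.
Proof. by rewrite big_ord_recl big_ord1. Qed.

Lemma vanish_diag (Z : 'I_2 -> 'M[algC]_2) : (forall s, is_diag_mx (Z s)) -> vanish Z.
Proof.
move=> dZ; refine (vanish_act (A0 := \matrix_(k, s) Z s k k) (A1 := 1%:M) (A2 := 1%:M) _ unit_vanish).
move=> s; rewrite trmx1 mul1mx mulmx1 sum_ord2.
have /is_diag_mxP dZs := dZ s.
apply: mx2P; rewrite !mxE /= ?mulr1 ?mulr0 ?addr0 ?add0r //; exact: dZs.
Qed.

(** Gaussian elimination with pivot g: Z e0 = U^T D L with D diagonal, while U^T and L leave the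
    matrix unit E_00 unchanged, so both slices become diagonal together. *)
Lemma vanish_upper_unit (Z : 'I_2 -> 'M[algC]_2) :
  Z e1 = (Z e1 e0 e0) *: delta_mx e0 e0 -> Z e0 e1 e1 != 0 -> vanish Z.
Proof.
move=> Z1 g0; set g := Z e0 e1 e1 in g0.
pose b := Z e0 e0 e1 / g; pose e := Z e0 e1 e0 / g.
pose U : 'M[algC]_2 := 1%:M + b *: delta_mx e1 e0.
pose L : 'M[algC]_2 := 1%:M + e *: delta_mx e1 e0.
pose D s : 'M[algC]_2 := if s == e0 then
   (Z e0 e0 e0 - b * g * e) *: delta_mx e0 e0 + g *: delta_mx e1 e1
   else Z e1 e0 e0 *: delta_mx e0 e0.
apply: (@vanish_act 1%:M U L D); last first.
  apply: vanish_diag => s; apply/is_diag_mxP => i j ij; rewrite /D; case: ifP => _; rewrite !mxE;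
    move: ij; case: (unliftP ord0 i) => [i'|] ->; case: (unliftP ord0 j) => [j'|] -> //=;
    by rewrite ?(ord1 i') ?(ord1 j') /= ?mulr0 ?addr0.
move=> s; rewrite sum_ord2; have [->|->] : s = e0 \/ s = e1.
  by case: (unliftP ord0 s) => [j|] ->; [right; rewrite (ord1 j) | left].
  rewrite !mxE /= scale1r scale0r addr0.
  apply: mx2P; rewrite !mxE !sum_ord2 !mxE !sum_ord2 /= /D /= !mxE /=; rewrite -/g /b /e; by field.
rewrite {1}Z1; apply: mx2P; rewrite !mxE !sum_ord2 !mxE !sum_ord2 /= /D /= !mxE /=; by ring.
Qed.

Lemma vanish_unit (Z : 'I_2 -> 'M[algC]_2) c : Z e1 = c *: delta_mx e0 e0 -> vanish Z.
Proof.
move=> Z1; pose D (s : 'I_2) : 'M[algC]_2 := if s == e0 then delta_mx e1 e1 else 0.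
(* Moving the first slice along E_11 makes the pivot nonzero except at x = - Z e0 e1 e1. *)
apply: (@vanish_line Z D ('X + (Z e0 e1 e1)%:P)) => [|x].
  by rewrite -size_poly_eq0 size_XaddC.
rewrite hornerD hornerX hornerC => x0; apply: vanish_upper_unit; rewrite /D /= ?scaler0 ?addr0.
  by rewrite Z1 !mxE /= mulr1.
by rewrite !mxE /= mulr1 addrC.
Qed.

(** A singular 2 x 2 slice has rank at most 1, and its rank normal form is 0 or E_00. *)
Lemma vanish_sing (Z : 'I_2 -> 'M[algC]_2) : \det (Z e1) = 0 -> vanish Z.
Proof.
move=> d1; pose C := col_ebase (Z e1); pose R := row_ebase (Z e1).
have [uC uR] : C \in unitmx /\ R \in unitmx by rewrite col_ebase_unit row_ebase_unit.
have r1 : (\rank (Z e1) <= 1)%N.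
  rewrite -ltnS ltn_neqAle rank_leq_row andbT; apply/negP => /eqP fullr.
  have : Z e1 \in unitmx by rewrite -row_free_unit /row_free fullr.
  by rewrite unitmxE d1 unitr0.
pose Z' s := invmx C *m Z s *m invmx R.
apply: (@vanish_act 1%:M C^T R Z').
  move=> s; rewrite trmxK sum_ord2; have [->|->] : s = e0 \/ s = e1.
    by case: (unliftP ord0 s) => [j|] ->; [right; rewrite (ord1 j) | left].
    by rewrite !mxE /= scale1r scale0r addr0 /Z' !mulmxA mulmxV // mul1mx mulmxKV.
  by rewrite !mxE /= scale1r scale0r add0r /Z' !mulmxA mulmxV // mul1mx mulmxKV.
apply: (@vanish_unit _ ((0 < \rank (Z e1))%N%:R)).
rewrite /Z' -[Z e1 in X in X *m _]mulmx_ebase -!mulmxA mulKmx // mulmxV // mulmx1.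
apply: mx2P; rewrite !mxE /= ?mulr0 ?mulr1 //.
by case: (\rank _) r1 => [|[|k]].
Qed.

(** Every pencil contains a singular member that can be made the second slice: [Z e0] itself, or
    else Z e1 - a Z e0 for an eigenvalue a of Z e1 (Z e0)^-1. *)
Lemma vanish_all (Z : 'I_2 -> 'M[algC]_2) : vanish Z.
Proof.
have [d0|d0] := eqVneq (\det (Z e0)) 0.
  pose Z' (s : 'I_2) := if s == e0 then Z e1 else Z e0.
  apply: (@vanish_act (delta_mx e0 e1 + delta_mx e1 e0) 1%:M 1%:M Z'); last exact: vanish_sing.
  move=> s; rewrite trmx1 mul1mx mulmx1 sum_ord2; have [->|->] : s = e0 \/ s = e1.
    by case: (unliftP ord0 s) => [j|] ->; [right; rewrite (ord1 j) | left].
    by rewrite !mxE /= ?addr0 ?add0r scale1r scale0r ?addr0 ?add0r.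
  by rewrite !mxE /= ?addr0 ?add0r scale1r scale0r ?addr0 ?add0r.
have u0 : Z e0 \in unitmx by rewrite unitmxE unitfE.
have [a] : exists a, root (char_poly (Z e1 *m invmx (Z e0))) a.
  by apply/closed_rootP; rewrite size_char_poly.
rewrite -eigenvalue_root_char => /eigenvalueP[v va v0].
have da : \det (Z e1 - a *: Z e0) = 0.
  apply/eqP/det0P; exists v => //.
  by rewrite mulmxBr -scalemxAr -{1}(mulmxKV u0 (Z e1)) !mulmxA -(mulmxA v) va -scalemxAl subrr.
pose Z' (s : 'I_2) := if s == e0 then Z e0 else Z e1 - a *: Z e0.
apply: (@vanish_act (1%:M + a *: delta_mx e0 e1) 1%:M 1%:M Z'); last exact: vanish_sing.
move=> s; rewrite trmx1 mul1mx mulmx1 sum_ord2; have [->|->] : s = e0 \/ s = e1.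
  by case: (unliftP ord0 s) => [j|] ->; [right; rewrite (ord1 j) | left].
  by rewrite !mxE /= !mulr0 !addr0 scale1r scale0r addr0.
by rewrite !mxE /= mulr1 mulr0 addr0 add0r scale1r addrC subrK.
Qed.

End BinaryTensors.

(* The orbit of the unit tensor e000 + e111 is dense in the 2 x 2 x 2 tensors. *)
Lemma krect2_le1 n : (krect 2 n <= 1)%N.
Proof.
pose GHZ := slices (fun s => delta_mx s s).
refine (has_dim_le1 (phi := fun v : {ffun 'I_(2 * n) -> {ffun 'I_3 -> 'I_2}} => \prod_p GHZ (v p))
  (krect_sym (erefl (2 * n)%N)) _) => f [cf sf] f0.
apply: tev_inj => [h v|X]; first by rewrite sf mul1r.
have unit0 : vanish f (fun s => delta_mx s s).
  by rewrite /vanish -[RHS]f0; apply: eq_bigr => w _; rewrite mulrC.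
have := vanish_all cf unit0 (fun a => \matrix_(b, c) X (triple a b c)) => <-.
apply: eq_tev => t; rewrite /slices mxE; congr X.
by apply/ffunP; apply: ord3P; rewrite !ffunE.
Qed.

Lemma krect1 n : krect 1 n = 1%N.
Proof.
pose o : {ffun 'I_(1 * n) -> {ffun 'I_3 -> 'I_1}} := [ffun p => [ffun i => ord0]].
have allo w : w = o by apply/ffunP => p; apply/ffunP => i; rewrite !ffunE ord1.
have sumo (F : _ -> algC) : \sum_w F w = F o.
  by rewrite (big_pred1 o) // => w; rewrite (allo w) /= eqxx.
have hk := krect_sym (erefl (1 * n)%N); apply/eqP; rewrite eqn_leq.
rewrite (has_dim_le1 (phi := fun=> 1) hk) /=; last first.
  by move=> f _; rewrite sumo mul1r => f0 t; rewrite (allo t).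
apply: (has_dim_gt0 (f := fun=> 1) (t := o) hk); last exact: oner_neq0.
split=> [A v|h v]; last by rewrite mul1r.
rewrite sumo mul1r mulr1; transitivity (\prod_(p < 1 * n) \prod_i \det (A i)).
  by apply: eq_bigr => p _; apply: eq_bigr => i _; rewrite det_mx11 !ord1.
by rewrite prodr_const card_ord mul1n prodrXl.
Qed.

(** * Self-conjugate characters and parity *)

Lemma even_sub_cube (n : int) : exists k, (1 - n) * n ^+ 2 = 2 * k.
Proof.
have : (n %% 2)%Z = 0 \/ (n %% 2)%Z = 1.
  have := modz_ge0 n (d := 2) isT; have := ltz_pmod n (d := 2) isT.
  by case: (n %% 2)%Z => [[|[|k]]|k] //; [left | right].
move: (divz_eq n 2); set q := (n %/ 2)%Z => nE [] rE; rewrite rE in nE; rewrite nE.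
  by exists ((1 - q * 2) * (q ^+ 2 * 2)); ring.
by exists (- q * (q * 2 + 1) ^+ 2); ring.
Qed.

Section IndexTwo.

Local Open Scope group_scope.
Local Open Scope ring_scope.

Variables (gT : finGroupType) (G H : {group gT}) (chi : 'CF(G)).
Hypotheses (nsHG : (H <| G)%g) (iHG : #|G : H|%g = 2%N) (irr_chi : chi \in irr G).
Hypothesis chi_out : forall x, x \in G -> x \notin H -> chi x = 0.

Let sHG : H \subset G := normal_sub nsHG.

Lemma index2_mulV y z : y \in G :\: H -> z \in G :\: H -> (y * z^-1)%g \in H.
Proof. by move=> Gy /(rcoset_index2 sHG iHG) E; rewrite -mem_rcoset E. Qed.

Lemma card_index2 : #|G|%:R = 2%:R * #|H|%:R :> algC.
Proof. by rewrite -natrM mulnC -iHG Lagrange. Qed.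

Lemma sum_out (F : gT -> algC) :
  (forall x, x \in G -> x \notin H -> F x = 0) -> \sum_(x in G) F x = \sum_(x in H) F x.
Proof.
move=> F0; rewrite (bigID (mem H)) /= [X in _ + X]big1 ?addr0; last by move=> x /andP[/F0].
by apply: eq_bigl => x; rewrite andb_idl // => /(subsetP sHG).
Qed.


(** As [chi] vanishes off [H], its restriction has norm 2. By Clifford's theorem this norm is e^2 t
    with t dividing 2, which forces e = 1 and t = 2: the restriction is the sum of two distinct
    conjugates, exchanged by every element outside [H]. *)
Lemma res_index2 : exists xi1 xi2 : 'CF(H),
  [/\ xi1 \in irr H, xi2 \in irr H, '[xi1, xi2] = 0, 'Res[H] chi = xi1 + xi2 &
    forall x y, y \in G :\: H -> xi1 (x ^ y)%g = xi2 x /\ xi2 (x ^ y)%g = xi1 x].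
Proof.
have nH : '['Res[H] chi] = 2%:R.
  have /irrP[i chiE] := irr_chi.
  have : '[chi] = 1 by rewrite chiE cfdot_irr eqxx.
  rewrite !cfdotE (@sum_out (fun x => chi x * (chi x)^*)) => [|x Gx nHx]; last first.
    by rewrite chi_out ?mul0r.
  move=> E; under eq_bigr => x Hx do rewrite !cfResE //.
  apply: (mulfI (x := 2%:R^-1)); first by rewrite invr_eq0 pnatr_eq0.
  by rewrite mulrA -invfM -card_index2 E mulVf // pnatr_eq0.
have /irrP[i chiE] := irr_chi; rewrite chiE in nH *.
have [j cj] := constt_cfRes_irr H i.
have cl := Clifford_Res_sum_cfclass nsHG cj; set e := '[_, _] in cl.
have eN : e \in Num.nat by rewrite Cnat_cfdot_char ?cfRes_char ?irr_char.
have clirr : {subset ('chi_j ^: G)%CF <= irr H}.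
  by move=> _ /cfclassP[y _ ->]; apply: cfConjg_irr (mem_irr j).
have orth := sub_orthonormal clirr (cfclass_uniq _ nsHG) (irr_orthonormal H).
rewrite cl cfnormZ cfnorm_orthonormal // size_cfclass in nH.
have sHI : H \subset 'I_G['chi_j] := sub_Inertia _ sHG.
have iI : (#|G : 'I_G['chi_j]|%g * #|'I_G['chi_j] : H|%g)%N = 2%N.
  by rewrite Lagrange_index ?subsetIl.
have [I2 e1] : #|G : 'I_G['chi_j]|%g = 2%N /\ e = 1.
  case/natrP: eN nH => k ->; rewrite normr_nat -natrX -natrM => /eqP; rewrite eqr_nat => /eqP.
  move: (#|G : _|%g) (#|_ : H|%g) iI => u v uv.
  have [u1|u2] : u = 1%N \/ u = 2%N.
    case: u uv => [|[|[|u]]] uv; [by [] | by left | by right |].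
    by case: v uv => [|v] uv; lia.
    rewrite u1 muln1; case: k => [|[|k]] // h; exfalso; move: h; rewrite expnS expn1; nia.
  by rewrite u2; case: k => [|[|k]] // h; exfalso; move: h; rewrite expnS expn1; nia.
have [y0 Gy0] : exists y0, y0 \in G :\: H.
  apply/set0Pn; rewrite -card_gt0 cardsD (setIidPr sHG) -(Lagrange sHG) iHG.
  by have := cardG_gt0 H; lia.
have [Gy0G Hy0] := setDP Gy0.
pose xi2 := ('chi_j ^ y0)%CF.
have IH : 'I_G['chi_j]%G :=: H.
  apply/eqP; rewrite eq_sym eqEcard sHI /=.
  have := Lagrange sHG; rewrite -(Lagrange (subsetIl G 'I['chi_j])) I2 iHG.
  by move/eqP; rewrite eqn_pmul2r // => /eqP ->.
have xi2ne : xi2 != 'chi_j.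
  apply/eqP => E; case/negP: Hy0; rewrite -IH inE Gy0G inE.
  by rewrite (subsetP (normal_norm nsHG)) //= [(_ ^ y0)%CF]E eqxx.
have xi2cl : xi2 \in ('chi_j ^: G)%CF by apply/cfclassP; exists y0.
have clE : perm_eq ('chi_j ^: G)%CF [:: 'chi_j; xi2].
  rewrite perm_sym uniq_perm ?cfclass_uniq //=; first by rewrite inE eq_sym xi2ne.
  have sub : {subset [:: 'chi_j; xi2] <= ('chi_j ^: G)%CF}.
    by move=> z; rewrite !inE => /orP[] /eqP ->; rewrite ?cfclass_refl.
  have u2 : uniq [:: 'chi_j; xi2] by rewrite /= inE eq_sym xi2ne.
  have [_ E] := uniq_min_size u2 sub (eq_leq (etrans (size_cfclass _ _) I2)).
  exact: E.
exists 'chi_j, xi2; split.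
- exact: mem_irr.
- exact/cfConjg_irr/mem_irr.
- have /irrP[k kE] : xi2 \in irr H by apply/cfConjg_irr/mem_irr.
  by rewrite kE cfdot_irr; move: xi2ne; rewrite kE (inj_eq irr_inj) eq_sym => /negPf ->.
- by rewrite cl e1 scale1r (perm_big _ clE) /= !big_cons big_nil addr0.
(* All elements outside [H] lie in one coset, so they conjugate in the same way as [y0]. *)
have step x y : y \in G :\: H -> xi2 (x ^ y)%g = 'chi_j x.
  move=> yGH; have [Gy Hy] := setDP yGH.
  have -> : xi2 = ('chi_j ^ y)%CF; last by rewrite cfConjgEJ // (subsetP (normal_norm nsHG)).
  have hH := index2_mulV yGH Gy0; rewrite /xi2 -(mulgKV y0 y) (cfConjgM _ nsHG) ?(subsetP sHG _ hH) //.
  by rewrite (cfConjg_id _ hH).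
move=> x y yGH; split; last exact: step.
rewrite -(step _ y^-1%g) ?conjgK //.
by have [Gy Hy] := setDP yGH; apply/setDP; rewrite !groupV.
Qed.

Hypothesis chi_int : forall x, x \in G -> chi x \in Num.int.
Hypothesis odd_cent : forall x, x \in H -> ('C_G[x] \subset H)%g -> odd #|'C_G[x]%g|.

(* chi restricts to xi1 + xi2 and psi = xi1 - xi2 vanishes at the elements of even centralizer;
   if <chi^2, chi> were 0, then sum_H (1 - chi)|psi|^2 = |G|, where the left-hand side is an
   even algebraic integer multiple of the 2-part of |G| since psi = chi mod 2. *)
Lemma cube_sum_neq0 : \sum_(x in G) chi x ^+ 3 != 0.
Proof.
have [xi1 [xi2 [irr1 irr2 xi12 resE conjE]]] := res_index2.
pose psi := xi1 - xi2; apply/eqP => cube0.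
have cChi x : x \in G -> (chi x)^* = chi x by move/chi_int/conj_intr.
have Nchi : chi \is a character by have /irrP[i ->] := irr_chi; apply: irr_char.
have [N1 N2] : xi1 \is a character /\ xi2 \is a character.
  by split; [have /irrP[i ->] := irr1 | have /irrP[i ->] := irr2]; apply: irr_char.
pose theta := 'Res[H] chi; have Nth : theta \is a character by apply: cfRes_char.
have cubeH : \sum_(x in H) chi x ^+ 3 = 0.
  by rewrite -sum_out // => x Gx Hx; rewrite chi_out // expr0n.
have th3 : '[theta * xi1 + theta * xi2, xi1 + xi2] = 0.
  rewrite -mulrDr -resE cfdotE (eq_bigr (fun x => chi x ^+ 3)) ?cubeH ?mulr0 // => x Hx.
  by rewrite !cfunE !cfResE // cChi ?(subsetP sHG) // !exprS expr0 mulr1 mulrA.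
have nn a b : a \is a character -> b \is a character -> 0 <= '[theta * a, b].
  by move=> Na Nb; apply: natr_ge0; apply: Cnat_cfdot_char; rewrite ?rpredM.
(* The four multiplicities in [th3] are nonnegative with sum 0; each vanishes, hence so does their
   signed sum. *)
have psi0 : '[theta * psi, psi] = 0.
  move: th3; rewrite /psi mulrBr cfdotBl !cfdotBr !cfdotDl !cfdotDr.
  have := nn _ _ N1 N1; have := nn _ _ N1 N2; have := nn _ _ N2 N1; have := nn _ _ N2 N2.
  move=> h22 h21 h12 h11 /eqP; rewrite paddr_eq0 ?addr_ge0 // !paddr_eq0 //.
  by case/andP => /andP[/eqP -> /eqP ->] /andP[/eqP -> /eqP ->]; rewrite !subr0.
have psi2 : '[psi] = 2%:R.
  rewrite /psi cfdotBl !cfdotBr xi12 ['[xi2, xi1]]cfdotC xi12 conjC0 subr0 sub0r opprK.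
  have /irrP[i ->] := irr1; have /irrP[k ->] := irr2.
  by rewrite !cfdot_irr !eqxx.
(* Conjugation outside [H] changes the sign of [psi], so only |psi|^2 gives a class function on
   G. *)
pose F x := if x \in H then (1 - chi x) * (psi x * (psi x)^*) else 0.
have sumF : \sum_(x in G) F x = #|G|%:R.
  rewrite sum_out => [|x _ /negPf]; last by rewrite /F => ->.
  have H0 : #|H|%:R != 0 :> algC by rewrite pnatr_eq0 -lt0n cardG_gt0.
  move: psi2 psi0; rewrite !cfdotE => /(canRL (mulVKf H0)) E1.
  move/(canRL (mulVKf H0)); rewrite mulr0 => E0.
  rewrite card_index2 [RHS]mulrC -[_ * 2%:R]subr0 -{2}E0 -E1 -sumrB; apply: eq_bigr => x Hx.
  by rewrite /F Hx mulrBl mul1r [(theta * psi) x]cfunE /theta cfResE // mulrA.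
have psiJ x y : x \in H -> y \in G -> psi (x ^ y)%g * (psi (x ^ y)%g)^* = psi x * (psi x)^*.
  move=> Hx Gy; have [Hy|Hy] := boolP (y \in H); first by rewrite cfunJ.
  have [E1 E2] := conjE x y (introT setDP (conj Gy Hy)).
  by rewrite !cfunE E1 E2 -[xi2 x - xi1 x]opprB rmorphN mulrNN.
have FJ : {in G &, forall x y, F (x ^ y)%g = F x}.
  move=> x y Gx Gy; rewrite /F memJ_norm ?(subsetP (normal_norm nsHG)) //.
  by case: ifP => // Hx; rewrite psiJ // cfunJ.
(* With psi = n - 2 b and n = chi(x), (1 - n)|psi|^2 equals (1 - n) n^2 plus twice an algebraic
   integer, and (1 - n) n^2 is even. *)
have F2 x : x \in H -> F x / 2%:R \in Aint.
  move=> Hx; have Gx := subsetP sHG x Hx.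
  have /intrP[n nE] := chi_int Gx; have [k kE] := even_sub_cube n.
  set b := xi2 x; have bA : b \in Aint by have /irrP[i bE] := irr2; rewrite /b bE Aint_irr.
  have bcA : b^* \in Aint by rewrite Aint_aut.
  have psiE : psi x = n%:~R - 2%:R * b.
    have := congr1 (fun phi : 'CF(H) => phi x) resE; rewrite cfResE // nE !cfunE => ->.
    by rewrite -/b; ring.
  have -> : F x / 2%:R = k%:~R + (1 - n%:~R) * (2%:R * b * b^* - n%:~R * (b + b^*)).
    apply: (canLR (mulfK _)); first by rewrite pnatr_eq0.
    rewrite /F Hx psiE nE rmorphB rmorphM /= rmorph_nat rmorph_int.
    have -> : (1 - n%:~R) * ((n%:~R - 2%:R * b) * (n%:~R - 2%:R * b^*)) =
      ((1 - n) * n ^+ 2)%:~R + 2%:R * ((1 - n%:~R) * (2%:R * b * b^* - n%:~R * (b + b^*))) :> algC.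
      by rewrite intrM rmorphXn /= intrB; ring.
    by rewrite kE intrM; ring.
  apply: rpredD; first exact: Aint_int.
  apply: rpredM; first by rewrite rpredB ?rpred1 ?Aint_int.
  apply: rpredB; first by apply: rpredM => //; apply: rpredM => //; apply: rpred_nat.
  by apply: rpredM; [apply: Aint_int | apply: rpredD].
pose p := (#|G|`_2)%N; pose o := (#|G|`_(2^'))%N.
have part : (p * o)%N = #|G| by rewrite partnC.
have P0 : p%:R != 0 :> algC by rewrite pnatr_eq0 -lt0n part_gt0.
have oddA : o%:R / 2%:R \in Aint.
  have -> : o%:R / 2%:R = #|G|%:R / (2%:R * p%:R) :> algC.
    by rewrite -part natrM; field; rewrite P0.
  rewrite -sumF (sum_by_classes FJ) mulr_suml rpred_sum // => xG /repr_classesP[].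
  set x := repr xG => Gx ->.
  have [Hx|Hx] := boolP (x \in H); last by rewrite /F (negPf Hx) mulr0 mul0r rpred0.
  (* An element outside [H] centralizing x exchanges xi1(x) and xi2(x), so psi(x) = 0. Otherwise the
     centralizer has odd order and the class size absorbs the 2-part of |G|. *)
  have [sC|/subsetPn[y]] := boolP ('C_G[x] \subset H); last first.
    move=> /setIP[Gy /cent1P cxy] Hy.
    have [E1 _] := conjE x y (introT setDP (conj Gy Hy)).
    have xy : (x ^ y)%g = x by rewrite conjgE -cxy mulKg.
    by rewrite xy in E1; rewrite /F Hx !cfunE E1 subrr mul0r !mulr0 mul0r rpred0.
  have cG : (#|'C_G[x]| * #|x ^: G|)%N = #|G| by rewrite -index_cent1 Lagrange // subsetIl.
  have cl2 : (p %| #|x ^: G|)%N.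
    rewrite /p -cG partnM ?cardG_gt0 //; last by rewrite -index_cent1 indexg_gt0.
    by rewrite part_p'nat ?mul1n ?dvdn_part // -odd_2'nat odd_cent.
  case/dvdnP: cl2 => q ->.
  have -> : (q * p)%:R * F x / (2%:R * p%:R) = q%:R * (F x / 2%:R).
    by rewrite natrM; field; rewrite P0.
  by rewrite rpredM ?rpred_nat ?F2.
have : (o%:R / 2%:R : algC) \in Num.int.
  by apply: (fun h => Cint_rat_Aint h oddA); rewrite rpred_div ?rpred_nat.
case/intrP => z /(canRL (divfK _)) /=; rewrite pnatr_eq0 => /(_ isT) E.
have : o%:Z = z * 2 by apply: (@intr_inj algC); rewrite intrM -E.
have : odd o by rewrite odd_2'nat part_pnat.
by move=> /[swap] /(congr1 absz); rewrite abszM absz_nat => ->; rewrite oddM andbF.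
Qed.

End IndexTwo.

(** * Permutations whose centralizer consists of even permutations *)

Section OddCentralizer.

Variable T : finType.
Local Open Scope group_scope.
Implicit Types (w x t : {perm T}) (i : T).

(* The restriction of w to the orbit of i is a cycle of even length commuting with x. *)
Lemma even_orbit_odd_commute w x i : commute w x -> x i \in porbit w i ->
  ~~ odd #|porbit w i| -> exists2 u : {perm T}, commute u x & odd_perm u.
Proof.
move=> cwx xO ev; pose O := porbit w i.
have wO z : (w z \in O) = (z \in O).
  by rewrite -!eq_porbit_mem -(porbit_perm w 1 z) expg1.
have xO1 z : z \in O -> x z \in O.
  move=> /porbitP[k ->]; have -> : x ((w ^+ k) i) = (w ^+ k) (x i).
    by rewrite -!permM (commuteX k (commute_sym cwx)).
  by rewrite -eq_porbit_mem porbit_perm eq_porbit_mem.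
have xOE z : (x z \in O) = (z \in O).
  apply/idP/idP; last exact: xO1.
  have sub : x @: O \subset O by apply/subsetP => _ /imsetP[y yO ->]; apply: xO1.
  have /eqP E : x @: O == O by rewrite eqEcard sub (card_imset _ (@perm_inj _ x)) leqnn.
  by rewrite -{1}E => /imsetP[y yO /perm_inj ->].
pose u0 z := if z \in O then w z else z.
have u0inj : injective u0.
  move=> y z; rewrite /u0; case: ifP => yO; case: ifP => zO //; first exact: perm_inj.
    by move=> E; move: zO; rewrite -E wO yO.
  by move=> E; move: yO; rewrite E wO zO.
pose u := perm u0inj.
have uE z : u z = if z \in O then w z else z by rewrite permE.
exists u.
  apply/permP => z; rewrite !permM !uE xOE; case: ifP => // zO.
  by rewrite -!permM cwx.
have uO k : (u ^+ k) i = (w ^+ k) i.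
  elim: k => [|k IH]; first by rewrite !expg0.
  by rewrite !expgSr !permM IH uE mem_porbit.
have pO z : z \in O -> porbit u z = O.
  move=> zO; have <- : porbit u i = O.
    by apply/setP => y; apply/porbitP/porbitP => -[k ->]; exists k; rewrite uO.
  apply/eqP; rewrite eq_porbit_mem; case/porbitP: zO => k ->; apply/porbitP.
  by exists k; rewrite uO.
have pN z : z \notin O -> porbit u z = [set z].
  move=> zO; have ufix k : (u ^+ k) z = z.
    by elim: k => [|k IH]; rewrite ?expg0 ?perm1 // expgSr permM IH uE (negPf zO).
  by apply/setP => y; rewrite inE; apply/porbitP/eqP => [[k ->]|->]; [|exists 0%N]; rewrite ufix.
have iO : i \in O := porbit_id w i.
have E : porbits u = O |: [set [set z] | z in ~: O].
  apply/setP => A; apply/imsetP/setU1P => [[z _ ->]|[->|/imsetP[z zO ->]]].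
  - have [zO|zO] := boolP (z \in O); [left; exact: pO | right].
    by rewrite pN //; apply/imsetP; exists z; rewrite ?inE.
  - by exists i; rewrite ?inE // pO.
  - by exists z; rewrite ?inE // pN //; rewrite inE in zO.
have ON : O \notin [set [set z] | z in ~: O].
  apply/imsetP => -[z]; rewrite inE => zO Oz; case/negP: zO; rewrite Oz; exact: set11.
(* [u] has 1 + |T| - |O| orbits, and the sign compares the parity of this number with that of
   |T|. *)
rewrite /odd_perm E cardsU1 ON card_imset; last exact: set1_inj.
rewrite cardsCs setCK oddD oddB ?max_card // (negPf ev) addbF /=.
by rewrite addbN addbb.
Qed.

(** Otherwise Cauchy gives an involution t commuting with x and moving some i. If the x-orbit of i
    has even length, its cycle is an odd permutation commuting with x; if it has odd length, the
    orbit of i under t x is even and serves instead. *)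
Lemma odd_card_cent1 x :
  (forall u : {perm T}, commute u x -> ~~ odd_perm u) -> odd #|'C[x]|.
Proof.
move=> ev; apply: contraT => evC; have : (2 %| #|'C[x]|)%N by rewrite dvdn2.
case/(Cauchy (isT : prime 2)) => t /cent1P ctx ot.
have t2 : t * t = 1 by have := expg_order t; rewrite ot.
have t1 : t != 1 by rewrite -order_eq1 ot.
have [i ti] : exists i, t i != i.
  apply/existsP; apply: contraR t1; rewrite negb_exists => /forallP h.
  by apply/eqP/permP => z; rewrite perm1; apply/eqP/negPn/h.
have cxt : commute x t by [].
have [odO|evO] := boolP (odd #|porbit x i|); last first.
  have [|u cu ou] := @even_orbit_odd_commute x x i (commute_refl x) _ evO.
    by have := mem_porbit x 1 i; rewrite expg1.
  by have := ev u cu; rewrite ou.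
have xm : (x ^+ #|porbit x i|) i = i by rewrite permX iter_porbit.
set m := #|porbit x i| in odO xm.
pose w := t * x.
have wk k : w ^+ k = t ^+ k * x ^+ k by apply: expgMn.
have teven k : ~~ odd k -> t ^+ k = 1.
  by move=> ek; rewrite -(even_halfK ek) -muln2 mulnC expgM expgS expg1 t2 expg1n.
have todd k : odd k -> t ^+ k = t.
  by move=> ok; rewrite -(prednK (odd_gt0 ok)) expgS teven ?mulg1 //;
    move: ok; case: k => //= k; rewrite negbK.
have [u cu ou] : exists2 u : {perm T}, commute u x & odd_perm u.
  apply: (@even_orbit_odd_commute w x i).
  - by rewrite /w /commute mulgA cxt.
  - have -> : x i = (w ^+ m.+1) i; last exact: mem_porbit.
    have em : ~~ odd m.+1 by rewrite /= negbK.
    by rewrite (wk m.+1) (teven _ em) mul1g expgSr permM xm.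
  (* If the w-orbit had odd length, t i would be x^a i for some a. Then x^(2a) fixes i, and on an
     orbit of odd length m so does x^a, since 2a (m+1)/2 = m a + a; this contradicts t i != i. *)
  - apply/negP => oL; set L := #|porbit w i| in oL.
    have : (w ^+ L) i = i by rewrite permX iter_porbit.
    rewrite wk todd // permM => xt.
    have xfix k n : (x ^+ k) i = i -> (x ^+ (k * n)) i = i.
      by move=> xk; elim: n => [|n IH]; rewrite ?muln0 ?expg0 ?perm1 // mulnS expgD permM xk.
    have /porbitP[a ta] : t i \in porbit x i.
      by rewrite porbit_sym; apply/porbitP; exists L; rewrite xt.
    have x2a : (x ^+ (a * 2)) i = i.
      have -> : x ^+ (a * 2) = x ^+ a * x ^+ a by rewrite -expgD addnn -muln2.
      by rewrite permM -ta -permM (commuteX a ctx) permM -ta -permM t2 perm1.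
    have E : (a * 2 * m.+1./2 = m * a + a)%N.
      by rewrite -mulnA [(2 * _)%N]mulnC muln2 even_halfK /= ?odO // mulnS addnC mulnC.
    have := xfix _ m.+1./2 x2a; rewrite E expgD permM (xfix _ a xm) -ta => tii.
    by rewrite tii eqxx in ti.
by have := ev u cu; rewrite ou.
Qed.

End OddCentralizer.

(** * Square and small shapes *)

Lemma det_tensor_reindex d m delta (row row' : 'I_d -> 'I_m) (col col' : 'I_d -> 'I_delta)
    (t u : 'S_d) : (forall p, row' p = row (t p)) -> (forall p, col' p = col (t p)) ->
  det_tensor row' col' (shift (rword row') u) = det_tensor row col (shift (rword row) (u ^ t)).
Proof.
move=> rE cE; have rwE : rword row' = shift (rword row) t.
  by apply/ffunP => p; rewrite !ffunE.
rewrite /det_tensor [RHS](reindex_inj (conjg_inj t)) /=; apply: eq_big => q.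
  apply/col_groupP/col_groupP => h i.
    by rewrite -[in RHS](permKV t i) -cE -h conjgE !permM cE.
  by have := h (t i); rewrite conjgE !permM permK !cE.
move=> _; rewrite odd_permJ rwE !shiftM !conjgE; congr (_ * _%:R).
by rewrite -(shift_eq _ _ t^-1) !shiftM.
Qed.

(** Two numberings of the same cells differ by a permutation, which conjugates the symmetrizers. It
    is applied to a square tableau and its transpose. *)
Lemma tableau_char_eq d m delta (row row' : 'I_d -> 'I_m) (col col' : 'I_d -> 'I_delta) :
  bijective (fun i => (row i, col i)) -> bijective (fun i => (row' i, col' i)) ->
  tableau_char row' col' =1 tableau_char row col.
Proof.
move=> bij bij' h; have [g gK Kg] := bij.
have tinj : injective (fun p => g (row' p, col' p)).
  by move=> p q E; apply: (bij_inj bij'); apply: (can_inj Kg).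
pose t := perm tinj.
have tE p : (row (t p), col (t p)) = (row' p, col' p) by rewrite permE Kg.
have rE p : row' p = row (t p) by have [-> _] := tE p.
have cE p : col' p = col (t p) by have [_ ->] := tE p.
have DE u := det_tensor_reindex u rE cE.
rewrite !tableau_charE; congr (_^-1 * _).
  rewrite (hook_constE bij) (hook_constE bij') [RHS](reindex_inj (conjg_inj t)) /=.
  by apply: eq_bigr => u _; rewrite !DE conjVg.
rewrite [RHS](reindex_inj (mulIg t)) /=; apply: eq_bigr => u _.
by rewrite DE conjgM.
Qed.

Lemma krect_square_gt0 n : (0 < n)%N -> (0 < krect n n)%N.
Proof.
(* The case n = 1 is apart because the alternating group has index 2 only when d > 1. *)
case: n => // -[_|n _]; first by rewrite krect1.
set N := n.+2; have [[row col] /= bij [rowE colE]] := rect_cells N N.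
set d := (N * N)%N in row col bij rowE colE *.
pose chi := cfRepr (specht_repr d (rect N N)).
have chiE h : chi h = tableau_char row col h := cfRepr_specht bij rowE colE h.
have Nchi : chi \is a character by apply: cfRepr_char.
have hc_int : hook_const row col \in Num.int.
  by rewrite (hook_constE bij) rpred_sum // => h _; rewrite rpredM ?det_tensor_int.
(* Rational by [tableau_charE], and an algebraic integer as a character value. *)
have chi_int h : chi h \in Num.int.
  apply: Cint_rat_Aint (Aint_char h Nchi).
  have int_Crat : {subset Num.int <= Crat} by move=> x /intrP[z ->]; apply: rpred_int.
  rewrite chiE tableau_charE; apply: rpredM; first by rewrite rpredV int_Crat.
  by apply: rpred_sum => g _; apply: int_Crat; apply: det_tensor_int.
have chi_real h : (chi h)^* = chi h by exact/conj_intr/chi_int.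
have d0 : d`!%:R != 0 :> algC by rewrite pnatr_eq0 -lt0n fact_gt0.
have chi0 : chi != 0.
  suff c1 : chi 1%g != 0 by apply: contraNneq c1 => ->; rewrite cfunE.
  rewrite chiE tableau_charE (eq_bigr (fun=> 1)) => [|g _].
    rewrite sumr_const card_Sn mulf_neq0 // invr_eq0 gt_eqF //.
    exact: (hook_const_gt0 bij).
  by rewrite invg1 conj1g shift1 (det_tensor_rword bij).
have irr_chi : chi \in irr [set: 'S_d].
  rewrite irrEchar Nchi /=; have [k hk kE] := irr_norm bij.
  have chi_norm : '[chi] = k%:R.
    rewrite kE cfdotE cardsT card_Sn; congr (_ * _); apply: eq_big => h; rewrite ?inE // => _.
    by rewrite chi_real chiE expr2.
  move: chi0; rewrite -cfnorm_eq0 chi_norm.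
  by case: k hk {kE chi_norm} => [|[|k]] /tinv_pair_le1; rewrite ?eqxx.
(* The transpose of a square is the same square numbered differently, so chi(h) = sgn(h) chi(h^-1),
   and chi is real. *)
have odd0 h : odd_perm h -> chi h = 0.
  move=> oh; have := tableau_char_transpose h bij.
  rewrite (tableau_char_eq bij (transpose_bij bij)) oh expr1 mulN1r -!chiE (char_inv _ Nchi) chi_real.
  by move/eqP; rewrite -subr_eq0 opprK -mulr2n mulrn_eq0 => /eqP.
have cd : (1 < #|'I_d|)%N by rewrite card_ord.
have := @cube_sum_neq0 _ [set: 'S_d]%G (Alt_group 'I_d) chi (Alt_normal _) (Alt_index cd) irr_chi.
have outA x : x \in [set: 'S_d] -> x \notin Alt 'I_d -> chi x = 0.
  by move=> _; rewrite Alt_even negbK => /odd0.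
have intA x : x \in [set: 'S_d] -> chi x \in Num.int by move=> _.
have centA (x : 'S_d) : x \in Alt 'I_d ->
    ('C_([set: 'S_d])[x] \subset Alt 'I_d)%g -> odd #|'C_([set: 'S_d])[x]%g|.
  move=> _; rewrite setTI => /subsetP sC; apply: odd_card_cent1 => u cu.
  by rewrite -Alt_even; apply/sC/cent1P.
move=> /(_ outA intA centA) cube.
rewrite lt0n -(pnatr_eq0 algC) (kroneckerE bij rowE colE) mulf_neq0 ?invr_eq0 //.
have <- : \sum_(h in [set: 'S_d]) chi h ^+ 3 = \sum_h tableau_char row col h ^+ 3.
  by apply: eq_big => h; rewrite ?inE // -chiE.
exact: cube.
Qed.

(** Positivity follows from k_2(2) > 0, the square case, by adding 2 repeatedly. *)
Lemma krect2_even n : (0 < n)%N -> ~~ odd n -> krect 2 n = 1%N.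
Proof.
move=> n0 en; apply/eqP; rewrite eqn_leq krect2_le1 /=.
have [k nE] : exists k, n = k.*2 by exists n./2; rewrite even_halfK.
move: n0; rewrite nE double_gt0; elim: k {n en nE} => // -[|k] IH _; first exact: krect_square_gt0.
have -> : (k.+2.*2 = k.+1.*2 + 2)%N by rewrite addn2.
by apply: krect_add; [apply: IH | apply: krect_square_gt0].
Qed.

Lemma krect3_gt0 n : (2 <= n)%N -> (0 < krect 3 n)%N.
Proof.
have k2 : (0 < krect 3 2)%N by rewrite (@krect_compl 2 1) ?krect1.
elim/ltn_ind: n => -[|[|[|[|n]]]] // IH _; first exact: krect_square_gt0.
by rewrite -[n.+4]addn2 krect_add ?IH.
Qed.

Lemma le_ceil_sqrt m k : (ceil_sqrt m <= k%:Z) = (m <= k ^ 2)%N.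
Proof.
have s0 : 0 <= sqrtC (m%:R : algC) by rewrite sqrtC_ge0 ler0n.
rewrite /ceil_sqrt real_ceil_le_int ?ger0_real // -[k%:Z%:~R]/(k%:R).
rewrite -(ler_pXn2r (n := 2)) ?nnegrE ?ler0n // sqrtCK -natrX.
exact: ler_nat.
Qed.

(** The strict inequality is the lower half of the condition that the rounded-up root of n^2 - j be
    n: a smaller k with positive coefficient would give n^2 - j <= k^2 <= (n - 1)^2. *)
Lemma krect_is_delta n j : (1 <= n)%N -> (j <= n ^ 2)%N -> ((n - 1) ^ 2 < n ^ 2 - j)%N ->
  (0 < krect j n)%N -> is_delta (n ^ 2 - j) n.
Proof.
move=> n1 jn lt kj; split=> //; first by rewrite krect_compl.
move=> k k1 /(krect_gt0_leq k1) le; rewrite leqNgt; apply/negP => kn.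
have : (k ^ 2 <= (n - 1) ^ 2)%N by rewrite leq_exp2r //; lia.
lia.
Qed.

Theorem theorem3p1 :
  (forall m : nat, (2 < m)%N ->
     exists delta : nat,
       [/\ is_delta m delta, ceil_sqrt m <= delta%:Z & (delta <= m)%N])
  /\
  (forall n : nat, (1 <= n)%N ->
     (forall j : nat, (j <= n ^ 2)%N -> krect (n ^ 2 - j) n = krect j n)
     /\
     (forall j : nat, (j <= n ^ 2)%N -> (2 < n ^ 2 - j)%N ->
        ceil_sqrt (n ^ 2 - j) = n%:Z -> (0 < krect j n)%N ->
        is_delta (n ^ 2 - j) n)
     /\
     (krect (n ^ 2 - 1) n = krect 1 n /\ krect 1 n = 1%N /\
      ((2 < n ^ 2 - 1)%N -> is_delta (n ^ 2 - 1) n))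
     /\
     (~~ odd n ->
        krect (n ^ 2 - 2) n = krect 2 n /\ krect 2 n = 1%N /\
        ((2 < n ^ 2 - 2)%N -> is_delta (n ^ 2 - 2) n))
     /\
     ((3 <= n)%N ->
        krect (n ^ 2 - 3) n = krect 3 n /\ (0 < krect 3 n)%N /\
        ((2 < n ^ 2 - 3)%N -> is_delta (n ^ 2 - 3) n))
     /\
     (krect (n ^ 2 - n) n = krect n n /\ (0 < krect n n)%N /\
      ((2 < n ^ 2 - n)%N -> is_delta (n ^ 2 - n) n))).
Proof.
split=> [m m2|n n1].
  have m0 : (0 < m)%N by apply: ltn_trans m2.
  (* The square m x m shows that the minimum exists and also bounds it by m. *)
  have ex : exists k, (0 < k)%N && (0 < krect m k)%N by exists m; rewrite m0 krect_square_gt0.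
  case: (ex_minnP ex) => k /andP[k0 kk] kmin; exists k; split.
  - by split=> // k' h1 h2; apply: kmin; rewrite h1.
  - by rewrite le_ceil_sqrt krect_gt0_leq.
  - by apply: kmin; rewrite m0 krect_square_gt0.
have sq : (n ^ 2 = n * n)%N by [].
have sq1 : ((n - 1) ^ 2 + 2 * n = n * n + 1)%N.
  by case: n n1 {sq} => // k _; rewrite subn1 /= -mulnn; ring.
have k1 := krect1 n; have kn := krect_square_gt0 n1.
split; first exact: krect_compl.
split=> [j jn _ cE kj|].
  apply: krect_is_delta => //; rewrite ltnNge; apply/negP => le.
  have : ceil_sqrt (n ^ 2 - j) <= (n - 1)%N%:Z by rewrite le_ceil_sqrt.
  by rewrite cE lez_nat; lia.
have nn : (n <= n * n)%N by rewrite leq_pmulr.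
split; first (split; first by rewrite krect_compl // sq; nia).
  by split=> // h; apply: krect_is_delta; rewrite ?k1 //; nia.
split=> [en|].
  have n2 : (2 <= n)%N by case: n n1 en {sq sq1 k1 kn nn} => [|[|n]].
  have k2 := krect2_even n1 en.
  rewrite krect_compl ?k2; last by nia.
  by do 2 split=> //; move=> h; apply: krect_is_delta; rewrite ?k2 //; nia.
split=> [n3|].
  have k3 : (0 < krect 3 n)%N by apply: krect3_gt0; apply: ltnW.
  rewrite krect_compl; last by nia.
  by do 2 split=> //; move=> h; apply: krect_is_delta => //; nia.
rewrite krect_compl; last by nia.
do 2 split=> //; move=> h.
(* For n = 1 the bound (n - 1)^2 < n^2 - n fails; the condition 2 < n^2 - n excludes this case. *)
have n2 : (1 < n)%N by case: n h {n1 sq sq1 k1 kn nn} => [|[|n]].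
by apply: krect_is_delta => //; nia.
Qed.
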